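(* Let $K$ be a field and let $(E,w)$ be an LV-rose such that there are edges of different weights (i.e. there are $e,f\in E^1$ with $w(e)\neq w(f)$). Then the weighted Leavitt path algebra $L_K(E,w)$ is a domain that is neither isomorphic as a $K$-algebra to a Leavitt path algebra $L_K(F)$ for any directed graph $F$, nor isomorphic as a $K$-algebra to a Leavitt algebra $L_K(n,n+k)$ for any integers $n\ge 1$, $k\ge 0$.
   Context: $\mathbb{N}$ denotes the positive integers. A domain is a nonzero ring without zero divisors. A directed graph is a quadruple $E=(E^0,E^1,s,r)$ with sets $E^0$ (vertices), $E^1$ (edges) and maps $s,r:E^1\to E^0$ (source, range). A weighted graph $(E,w)$ is a directed graph $E$ with a map $w:E^1\to\mathbb{N}$; all weighted graphs are assumed row-finite, i.e. $s^{-1}(v)$ is finite for every $v\in E^0$. For $v\in E^0$ put $w(v):=\max\{w(e)\mid e\in s^{-1}(v)\}$, with $\max\emptyset=0$. LV-rose: a weighted graph with exactly one vertex $v$ (so every edge is a loop at $v$, and there are finitely many edges) such that every edge has weight at least $2$ and at least two distinct edges have the maximal weight $w(v)$. The weighted Leavitt path algebra $L_K(E,w)$ is the associative $K$-algebra presented by generators $E^0\cup\{e_i,e_i^*\mid e\in E^1,1\le i\le w(e)\}$ and relations (i) $uv=\delta_{uv}u$ for $u,v\in E^0$; (ii) $s(e)e_i=e_i=e_ir(e)$ and $r(e)e_i^*=e_i^*=e_i^*s(e)$ for $e\in E^1$, $1\le i\le w(e)$; (iii) $\sum_{e\in s^{-1}(v)}e_ie_j^*=\delta_{ij}v$ for $v\in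 E^0$, $1\le i,j\le w(v)$; (iv) $\sum_{1\le i\le w(v)}e_i^*f_i=\delta_{ef}r(e)$ for $v\in E^0$, $e,f\in s^{-1}(v)$; where in (iii), (iv) one sets $e_i=e_i^*=0$ whenever $i>w(e)$. The Leavitt path algebra $L_K(F)$ of a directed graph $F$ is the associative $K$-algebra presented by generators $F^0\cup\{e,e^*\mid e\in F^1\}$ and relations $uv=\delta_{uv}u$ ($u,v\in F^0$); $s(e)e=e=er(e)$, $r(e)e^*=e^*=e^*s(e)$ ($e\in F^1$); $e^*f=\delta_{ef}r(e)$ ($e,f\in F^1$); and $\sum_{e\in s^{-1}(v)}ee^*=v$ for every $v\in F^0$ with $s^{-1}(v)$ finite and nonempty. (For row-finite $F$ this is the weighted Leavitt path algebra of $F$ with all weights equal to $1$.) The Leavitt algebra $L_K(n,n+k)$ is the unital associative $K$-algebra with generators $x_{ij},y_{ji}$ ($1\le i\le n$, $1\le j\le n+k$) and the relations stating that the matrices $X=(x_{ij})\in\mathbb{M}_{n\times(n+k)}$ and $Y=(y_{ji})\in\mathbb{M}_{(n+k)\times n}$ satisfy $XY=I_n$ and $YX=I_{n+k}$; equivalently, it is the weighted Leavitt path algebra of the weighted graph with one vertex and $n+k$ edges, each of weight $n$. *)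

(* Defs.v *)
From HB Require Import structures.
From mathcomp Require Import all_boot all_order all_algebra.
From mathcomp Require Import finmap.
From mathcomp Require Import boolp classical_sets cardinality.

Set Implicit Arguments.
Unset Strict Implicit.
Unset Printing Implicit Defensive.

Import GRing.Theory.

Local Open Scope ring_scope.
Local Open Scope quotient_scope.

(* Leavitt path algebras of graphs with infinitely many vertices have no unit,
   and MathComp's [algType] requires one (with 1 != 0), hence this structure of
   associative, not necessarily unital, algebras.  The product is the semigroup
   product [(x * y)%g]. *)
HB.mixin Record LmoduleSemigroup_isNUAlgebra (K : pzRingType) A
    of GRing.Lmodule K A & Semigroup A := {
  numulDl : forall x y z : A, ((x + y) * z)%g = (x * z)%g + (y * z)%g;
  numulDr : forall x y z : A, (x * (y + z))%g = (x * y)%g + (x * z)%g;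
  nuscaleAl : forall (k : K) (x y : A), k *: (x * y)%g = ((k *: x) * y)%g;
  nuscaleAr : forall (k : K) (x y : A), k *: (x * y)%g = (x * (k *: y))%g
}.

#[short(type="nuAlgType")]
HB.structure Definition NUAlgebra (K : pzRingType) :=
  {A of GRing.Lmodule K A & Semigroup A & LmoduleSemigroup_isNUAlgebra K A}.

Definition is_domain (K : pzRingType) (A : nuAlgType K) : Prop :=
  (exists a : A, a <> 0) /\
  (forall a b : A, (a * b)%g = 0 -> a = 0 \/ b = 0).

Definition alg_isomorphic (K : pzRingType) (A B : nuAlgType K) : Prop :=
  exists f : {linear A -> B},
    bijective f /\ (forall x y : A, f (x * y)%g = (f x * f y)%g).

(* The algebra presented by generators [X] and relations [R] is the quotient
   of the non-associative terms over [X] by the congruence generated by [R]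
   and the axioms of associative algebras. *)
Section Presentation.
Variables (K : pzRingType) (X : Type).

Inductive term : Type :=
  | TGen of X
  | TZero
  | TOpp of term
  | TAdd of term & term
  | TScale of K & term
  | TMul of term & term.

HB.instance Definition _ := gen_eqMixin term.
HB.instance Definition _ := gen_choiceMixin term.

Variable R : term -> term -> Prop.

Inductive cong : term -> term -> Prop :=
  | cong_rel s t : R s t -> cong s t
  | cong_refl t : cong t t
  | cong_sym s t : cong s t -> cong t s
  | cong_trans s t u : cong s t -> cong t u -> cong s u
  | cong_opp s t : cong s t -> cong (TOpp s) (TOpp t)
  | cong_add s s' t t' :
      cong s s' -> cong t t' -> cong (TAdd s t) (TAdd s' t')
  | cong_scale k s t : cong s t -> cong (TScale k s) (TScale k t)
  | cong_mul s s' t t' :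
      cong s s' -> cong t t' -> cong (TMul s t) (TMul s' t')
  | cong_addA s t u : cong (TAdd s (TAdd t u)) (TAdd (TAdd s t) u)
  | cong_addC s t : cong (TAdd s t) (TAdd t s)
  | cong_add0 t : cong (TAdd TZero t) t
  | cong_addN t : cong (TAdd (TOpp t) t) TZero
  | cong_scaleA k l t : cong (TScale k (TScale l t)) (TScale (k * l) t)
  | cong_scale1 t : cong (TScale 1 t) t
  | cong_scaleDr k s t :
      cong (TScale k (TAdd s t)) (TAdd (TScale k s) (TScale k t))
  | cong_scaleDl k l t :
      cong (TScale (k + l) t) (TAdd (TScale k t) (TScale l t))
  | cong_mulA s t u : cong (TMul s (TMul t u)) (TMul (TMul s t) u)
  | cong_mulDl s t u :
      cong (TMul (TAdd s t) u) (TAdd (TMul s u) (TMul t u))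
  | cong_mulDr s t u :
      cong (TMul s (TAdd t u)) (TAdd (TMul s t) (TMul s u))
  | cong_scaleAl k s t : cong (TScale k (TMul s t)) (TMul (TScale k s) t)
  | cong_scaleAr k s t : cong (TScale k (TMul s t)) (TMul s (TScale k t)).

Definition congb (s t : term) : bool := `[< cong s t >].

Lemma congb_refl : reflexive congb.
Proof. by move=> t; apply/asboolP; exact: cong_refl. Qed.

Lemma congb_sym : symmetric congb.
Proof. by move=> s t; apply/asboolP/asboolP; exact: cong_sym. Qed.

Lemma congb_trans : transitive congb.
Proof.
by move=> t s u /asboolP st /asboolP tu; apply/asboolP; exact: cong_trans st tu.
Qed.

Canonical congb_equiv := EquivRel congb congb_refl congb_sym congb_trans.

Definition presented : Type := {eq_quot congb_equiv}.

HB.instance Definition _ := Choice.on presented.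

Definition cls (t : term) : presented := \pi_({eq_quot congb_equiv}) t.
Definition rep (x : presented) : term := repr (x : {eq_quot congb_equiv}).

Lemma clsP (s t : term) : cls s = cls t <-> cong s t.
Proof.
split; first by move=> /(@eqmodP _ congb_equiv) /asboolP.
by move=> st; apply/(@eqmodP _ congb_equiv)/asboolP.
Qed.

Lemma repK : cancel rep cls.
Proof. by move=> x; exact: reprK. Qed.

Lemma cls_rep (t : term) : cong (rep (cls t)) t.
Proof. by apply/clsP; rewrite repK. Qed.

Definition padd (x y : presented) := cls (TAdd (rep x) (rep y)).
Definition popp (x : presented) := cls (TOpp (rep x)).
Definition pscale (k : K) (x : presented) := cls (TScale k (rep x)).
Definition pmul (x y : presented) := cls (TMul (rep x) (rep y)).

Lemma cls_add s t : cls (TAdd s t) = padd (cls s) (cls t).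
Proof. by apply/clsP/cong_add; apply/cong_sym/cls_rep. Qed.

Lemma cls_opp t : cls (TOpp t) = popp (cls t).
Proof. by apply/clsP/cong_opp; apply/cong_sym/cls_rep. Qed.

Lemma cls_scale k t : cls (TScale k t) = pscale k (cls t).
Proof. by apply/clsP/cong_scale; apply/cong_sym/cls_rep. Qed.

Lemma cls_mul s t : cls (TMul s t) = pmul (cls s) (cls t).
Proof. by apply/clsP/cong_mul; apply/cong_sym/cls_rep. Qed.

Lemma cls_ind (P : presented -> Prop) :
  (forall t, P (cls t)) -> forall x, P x.
Proof. by move=> Pcls x; rewrite -(repK x); exact: Pcls. Qed.

Lemma paddA : associative padd.
Proof.
elim/cls_ind=> s; elim/cls_ind=> t; elim/cls_ind=> u.
by rewrite -!cls_add; apply/clsP/cong_addA.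
Qed.

Lemma paddC : commutative padd.
Proof.
elim/cls_ind=> s; elim/cls_ind=> t.
by rewrite -!cls_add; apply/clsP/cong_addC.
Qed.

Lemma padd0 : left_id (cls TZero) padd.
Proof. by elim/cls_ind=> t; rewrite -cls_add; apply/clsP/cong_add0. Qed.

Lemma paddN : left_inverse (cls TZero) popp padd.
Proof.
by elim/cls_ind=> t; rewrite -cls_opp -cls_add; apply/clsP/cong_addN.
Qed.

HB.instance Definition _ :=
  GRing.isZmodule.Build presented paddA paddC padd0 paddN.

Lemma clsD s t : cls (TAdd s t) = cls s + cls t.
Proof. exact: cls_add. Qed.

Lemma pscaleA k l (x : presented) : pscale k (pscale l x) = pscale (k * l) x.
Proof.
by elim/cls_ind: x => t; rewrite -!cls_scale; apply/clsP/cong_scaleA.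
Qed.

Lemma pscale1 : left_id 1 pscale.
Proof. by elim/cls_ind=> t; rewrite -cls_scale; apply/clsP/cong_scale1. Qed.

Lemma pscaleDr : right_distributive pscale +%R.
Proof.
move=> k; elim/cls_ind=> s; elim/cls_ind=> t.
rewrite -clsD -!cls_scale -clsD.
exact/clsP/cong_scaleDr.
Qed.

Lemma pscaleDl (x : presented) : {morph pscale^~ x : k l / k + l}.
Proof.
move=> k l; elim/cls_ind: x => t.
rewrite -!cls_scale -clsD.
exact/clsP/cong_scaleDl.
Qed.

HB.instance Definition _ := GRing.Zmodule_isLmodule.Build K presented
  pscaleA pscale1 pscaleDr pscaleDl.

Lemma clsZ k t : cls (TScale k t) = k *: cls t.
Proof. exact: cls_scale. Qed.

HB.instance Definition _ := hasMul.Build presented pmul.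

Lemma clsM s t : cls (TMul s t) = (cls s * cls t)%g.
Proof. exact: cls_mul. Qed.

Lemma pmulA : associative pmul.
Proof.
elim/cls_ind=> s; elim/cls_ind=> t; elim/cls_ind=> u.
by rewrite -!cls_mul; apply/clsP/cong_mulA.
Qed.

HB.instance Definition _ := Magma_isSemigroup.Build presented pmulA.

Lemma pmulDl (x y z : presented) : ((x + y) * z)%g = (x * z)%g + (y * z)%g.
Proof.
elim/cls_ind: x => s; elim/cls_ind: y => t; elim/cls_ind: z => u.
rewrite -clsD -!clsM -clsD.
exact/clsP/cong_mulDl.
Qed.

Lemma pmulDr (x y z : presented) : (x * (y + z))%g = (x * y)%g + (x * z)%g.
Proof.
elim/cls_ind: x => s; elim/cls_ind: y => t; elim/cls_ind: z => u.
rewrite -clsD -!clsM -clsD.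
exact/clsP/cong_mulDr.
Qed.

Lemma pscaleAl k (x y : presented) : k *: (x * y)%g = ((k *: x) * y)%g.
Proof.
elim/cls_ind: x => s; elim/cls_ind: y => t.
rewrite -clsZ -!clsM -clsZ.
exact/clsP/cong_scaleAl.
Qed.

Lemma pscaleAr k (x y : presented) : k *: (x * y)%g = (x * (k *: y))%g.
Proof.
elim/cls_ind: x => s; elim/cls_ind: y => t.
rewrite -clsZ -!clsM -clsZ.
exact/clsP/cong_scaleAr.
Qed.

HB.instance Definition _ := LmoduleSemigroup_isNUAlgebra.Build K presented
  pmulDl pmulDr pscaleAl pscaleAr.

End Presentation.

Arguments TZero {K X}.
Arguments TGen {K X}.

Declare Scope presentation_scope.
Delimit Scope presentation_scope with PR.
Bind Scope presentation_scope with term.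
Notation "0" := TZero : presentation_scope.
Notation "s * t" := (TMul s t) : presentation_scope.
Notation "\sum_ ( i <- r ) F" :=
  (\big[@TAdd _ _/TZero]_(i <- r) F%PR) : presentation_scope.
Notation "\sum_ ( i < n ) F" :=
  (\big[@TAdd _ _/TZero]_(i < n) F%PR) : presentation_scope.

(* Vertices and edges form [choiceType]s; classically every type carries such a
   structure, so this does not restrict the graphs. *)
Record digraph : Type := Digraph {
  vertex : choiceType;
  edge : choiceType;
  src : edge -> vertex;
  rng : edge -> vertex
}.

Definition out_edges (F : digraph) (v : vertex F) : set (edge F) :=
  [set e | src e = v]%classic.

Record wgraph : Type := WGraph {
  wgraph_digraph :> digraph;
  wt : edge wgraph_digraph -> nat;
  wt_gt0 : forall e, (0 < wt e)%N;
  row_finite : forall v : vertex wgraph_digraph, finite_set (out_edges v)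
}.

Arguments wt {_}.

(* [fset_set A] is the set [A] as a finite set when it is finite. *)
Definition vwt (E : wgraph) (v : vertex E) : nat :=
  \max_(e <- fset_set (out_edges v)) wt e.

Definition LV_rose (E : wgraph) : Prop :=
  exists v : vertex E,
    [/\ forall u : vertex E, u = v,
        forall e : edge E, (2 <= wt e)%N
      & exists e f : edge E, [/\ e <> f, wt e = vwt v & wt f = vwt v]].

Section WeightedLeavittPathAlgebra.
Variables (K : fieldType) (E : wgraph).

(* [WEdge e i] and [WGhost e i] are the generators e_(i+1) and e_(i+1)^*:
   the second index is counted from 0 here and in the relations. *)
Inductive wLPA_gen : Type :=
  | WVertex of vertex E
  | WEdge (e : edge E) of 'I_(wt e)
  | WGhost (e : edge E) of 'I_(wt e).

Notation trm := (term K wLPA_gen).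

Definition w_vertex (v : vertex E) : trm := TGen (WVertex v).

(* These are zero for indices exceeding the weight of the edge. *)
Definition w_edge (e : edge E) (i : nat) : trm :=
  if insub i is Some j then TGen (@WEdge e j) else TZero.

Definition w_ghost (e : edge E) (i : nat) : trm :=
  if insub i is Some j then TGen (@WGhost e j) else TZero.

Local Open Scope presentation_scope.

Inductive wLPA_rel : trm -> trm -> Prop :=
  | wLPA_vertex u v :
      wLPA_rel (w_vertex u * w_vertex v) (if u == v then w_vertex u else 0)
  | wLPA_src_edge e (i : 'I_(wt e)) :
      wLPA_rel (w_vertex (src e) * w_edge e i) (w_edge e i)
  | wLPA_edge_rng e (i : 'I_(wt e)) :
      wLPA_rel (w_edge e i * w_vertex (rng e)) (w_edge e i)
  | wLPA_rng_ghost e (i : 'I_(wt e)) :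
      wLPA_rel (w_vertex (rng e) * w_ghost e i) (w_ghost e i)
  | wLPA_ghost_src e (i : 'I_(wt e)) :
      wLPA_rel (w_ghost e i * w_vertex (src e)) (w_ghost e i)
  | wLPA_edge_ghost v (i j : 'I_(vwt v)) :
      wLPA_rel (\sum_(e <- fset_set (out_edges v)) (w_edge e i * w_ghost e j))
               (if i == j then w_vertex v else 0)
  | wLPA_ghost_edge v e f : src e = v -> src f = v ->
      wLPA_rel (\sum_(i < vwt v) (w_ghost e i * w_edge f i))
               (if e == f then w_vertex (rng e) else 0).

Definition wLPA : nuAlgType K := presented wLPA_rel.

End WeightedLeavittPathAlgebra.

Section LeavittPathAlgebra.
Variables (K : fieldType) (F : digraph).

Inductive LPA_gen : Type :=
  | PVertex of vertex F
  | PEdge of edge F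
  | PGhost of edge F.

Notation trm := (term K LPA_gen).

Definition p_vertex (v : vertex F) : trm := TGen (PVertex v).
Definition p_edge (e : edge F) : trm := TGen (PEdge e).
Definition p_ghost (e : edge F) : trm := TGen (PGhost e).

Local Open Scope presentation_scope.

Inductive LPA_rel : trm -> trm -> Prop :=
  | LPA_vertex u v :
      LPA_rel (p_vertex u * p_vertex v) (if u == v then p_vertex u else 0)
  | LPA_src_edge e : LPA_rel (p_vertex (src e) * p_edge e) (p_edge e)
  | LPA_edge_rng e : LPA_rel (p_edge e * p_vertex (rng e)) (p_edge e)
  | LPA_rng_ghost e : LPA_rel (p_vertex (rng e) * p_ghost e) (p_ghost e)
  | LPA_ghost_src e : LPA_rel (p_ghost e * p_vertex (src e)) (p_ghost e)
  | LPA_ghost_edge e f :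
      LPA_rel (p_ghost e * p_edge f) (if e == f then p_vertex (rng e) else 0)
  | LPA_edge_ghost v :
      finite_set (out_edges v) -> (out_edges v !=set0)%classic ->
      LPA_rel (\sum_(e <- fset_set (out_edges v)) (p_edge e * p_ghost e))
              (p_vertex v).

Definition LPA : nuAlgType K := presented LPA_rel.

End LeavittPathAlgebra.

Section LeavittAlgebra.
Variables (K : fieldType) (n m : nat).

(* The unit of the Leavitt algebra of type (n, m) is an additional generator,
   subject to the relations saying that it is neutral for each generator. *)
Inductive leavitt_gen : Type :=
  | LOne
  | LX of 'I_n & 'I_m
  | LY of 'I_m & 'I_n.

Notation trm := (term K leavitt_gen).

Definition l_one : trm := TGen LOne.
Definition l_x (i : 'I_n) (j : 'I_m) : trm := TGen (LX i j).
Definition l_y (j : 'I_m) (i : 'I_n) : trm := TGen (LY j i).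

Local Open Scope presentation_scope.

Inductive leavitt_rel : trm -> trm -> Prop :=
  | leavitt_1l g : leavitt_rel (l_one * TGen g) (TGen g)
  | leavitt_1r g : leavitt_rel (TGen g * l_one) (TGen g)
  | leavitt_XY i k :
      leavitt_rel (\sum_(j < m) (l_x i j * l_y j k))
                  (if i == k then l_one else 0)
  | leavitt_YX j l :
      leavitt_rel (\sum_(i < n) (l_y j i * l_x i l))
                  (if j == l then l_one else 0).

Definition leavitt : nuAlgType K := presented leavitt_rel.

End LeavittAlgebra.

(* Main.v *)
(* Let r be the least weight of the rose and N > r its maximal weight.

   Domain: rewriting the products e_i e_j^* for one chosen edge e of maximal
   weight, and all the e_1^* f_1, gives normal forms such that a product of two
   normal words reduces in a single step.  The top degree coefficients of ab are
   then products of coefficients of a and of b, up to at most one correction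
   term of the same form; a second edge of maximal weight (for the index 1, the
   index 2) shows that they cannot all vanish.

   Leavitt path algebras: a domain L_K(F) has at most one nonzero vertex and one
   nonzero edge, hence is commutative.

   Leavitt algebras: let the algebras act on a space V of countable dimension.
   An action of L_K(n,m) is an isomorphism between V^m and V^n, so it can be
   prescribed on any finite set of vectors at the cost of a perturbation of
   finite rank.  In the rose algebra let X be the matrix (e_i) with i <= r and e
   of weight r, and Y that of the e_i^*, so that YX = 1.  If XY = 1 in one action,
   this persists under perturbations of finite rank, since an injective operator
   of Fredholm index zero is bijective.  As there is an action in which XY = 1
   and another one in which XY <> 1, there is no isomorphism. *)
From HB Require Import structures.
Require Import Defs.
From mathcomp Require Import all_boot all_order all_algebra.
From mathcomp Require Import finmap.
From mathcomp Require Import boolp classical_sets functions cardinality.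
From mathcomp Require Import zify.

Set Implicit Arguments.
Unset Strict Implicit.
Unset Printing Implicit Defensive.

Import GRing.Theory.

Local Open Scope ring_scope.

(** * Modules over presented algebras *)

Section NUAlgebraTheory.
Variables (K : pzRingType) (A : nuAlgType K).
Implicit Types (x y : A).

Lemma numul0l x : ((0 : A) * x)%g = 0.
Proof. by apply: (addrI (0 * x)%g); rewrite -numulDl !addr0. Qed.

Lemma numul0r x : (x * (0 : A))%g = 0.
Proof. by apply: (addrI (x * 0)%g); rewrite -numulDr !addr0. Qed.

Lemma numulNl x y : ((- x) * y)%g = - (x * y)%g.
Proof. by apply: (addrI (x * y)%g); rewrite -numulDl !subrr numul0l. Qed.

Lemma numulNr x y : (x * - y)%g = - (x * y)%g.
Proof. by apply: (addrI (x * y)%g); rewrite -numulDr !subrr numul0r. Qed.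

Lemma numul_sumr I (r : seq I) (P : pred I) (F : I -> A) x :
  (x * \sum_(i <- r | P i) F i)%g = \sum_(i <- r | P i) (x * F i)%g.
Proof. by apply: (big_morph (fun y => x * y)%g) => [y z|]; rewrite ?numulDr ?numul0r. Qed.

Lemma numul_suml I (r : seq I) (P : pred I) (F : I -> A) x :
  ((\sum_(i <- r | P i) F i)%R * x)%g = \sum_(i <- r | P i) (F i * x)%g.
Proof. by apply: (big_morph (fun y => y * x)%g) => [y z|]; rewrite ?numulDl ?numul0l. Qed.

End NUAlgebraTheory.

Section Evaluation.
Variables (K : fieldType) (X : Type) (V : lmodType K) (rho : X -> {linear V -> V}).

Fixpoint ev (t : term K X) (u : V) : V :=
  match t with
  | TGen x => rho x u
  | TZero => 0
  | TOpp s => - ev s u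
  | TAdd s t => ev s u + ev t u
  | TScale k s => k *: ev s u
  | TMul s t => ev s (ev t u)
  end.

Lemma ev_is_linear t : linear (ev t).
Proof.
elim: t => [x||s IHs|s IHs t IHt|l s IHs|s IHs t IHt] k u u' /=.
- exact: linearP.
- by rewrite scaler0 addr0.
- by rewrite IHs opprD scalerN.
- by rewrite IHs IHt scalerDr addrACA.
- by rewrite IHs scalerDr !scalerA mulrC.
- by rewrite IHt IHs.
Qed.

HB.instance Definition _ t :=
  GRing.isLinear.Build K V V *:%R (ev t) (ev_is_linear t).

Lemma ev_sum I (r : seq I) (F : I -> term K X) u :
  ev (\big[@TAdd K X/TZero]_(i <- r) F i) u = \sum_(i <- r) ev (F i) u.
Proof. by elim/big_rec2: _ => [//|i x t _ <-]. Qed.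

Variable R : term K X -> term K X -> Prop.
Hypothesis rhoR : forall s t, R s t -> ev s =1 ev t.

Lemma ev_cong s t : cong R s t -> ev s =1 ev t.
Proof.
move=> st; elim: {s t}st => //=.
- by move=> s t _ IH u; rewrite IH.
- by move=> s t t' _ IH1 _ IH2 u; rewrite IH1 IH2.
- by move=> s t _ IH u; rewrite IH.
- by move=> s s' t t' _ IHs _ IHt u; rewrite IHs IHt.
- by move=> k s t _ IH u; rewrite IH.
- by move=> s s' t t' _ IHs _ IHt u; rewrite IHs IHt.
- by move=> s t t' u; rewrite addrA.
- by move=> s t u; rewrite addrC.
- by move=> t u; rewrite add0r.
- by move=> t u; rewrite addNr.
- by move=> k l t u; rewrite scalerA.
- by move=> t u; rewrite scale1r.
- by move=> k s t u; rewrite scalerDr.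
- by move=> k l t u; rewrite scalerDl.
- by move=> s t t' u; rewrite linearD.
- by move=> k s t u; rewrite linearZ.
Qed.

(** Taken through the chosen representative, so that it is a linear map for every [rho];
    compatibility with the relations enters through [act_cls]. *)
Definition act (a : presented R) : V -> V := ev (rep a).

HB.instance Definition _ (a : presented R) :=
  GRing.isLinear.Build K V V *:%R (act a) (ev_is_linear (rep a)).

Lemma act_cls t : act (cls R t) =1 ev t.
Proof. exact/ev_cong/cls_rep. Qed.

Lemma act0 u : act 0 u = 0. Proof. by rewrite act_cls. Qed.
Lemma actD a b u : act (a + b) u = act a u + act b u.
Proof. by rewrite act_cls. Qed.
Lemma actZ k a u : act (k *: a) u = k *: act a u.
Proof. by rewrite act_cls. Qed.
Lemma actM a b u : act (a * b)%g u = act a (act b u).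
Proof. by rewrite act_cls. Qed.
Lemma act_sum I (r : seq I) (F : I -> presented R) u :
  act (\sum_(i <- r) F i) u = \sum_(i <- r) act (F i) u.
Proof.
by apply: (big_morph (fun a => act a u)) => [a b|]; rewrite ?actD ?act0.
Qed.

End Evaluation.

Section PresentedTheory.
Variables (K : fieldType) (X : Type) (R : term K X -> term K X -> Prop).

Lemma clsN t : cls R (TOpp t) = - cls R t. Proof. exact: cls_opp. Qed.
Lemma cls0 : cls R TZero = 0. Proof. by []. Qed.
Lemma cls_sum I (r : seq I) (F : I -> term K X) :
  cls R (\big[@TAdd K X/TZero]_(i <- r) F i) = \sum_(i <- r) cls R (F i).
Proof. by elim/big_rec2: _ => [//|i x t _ <-]; rewrite clsD. Qed.

(** An opposite is the multiple by -1, so closure under scalars covers it. *)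
Lemma presented_ind (P : presented R -> Prop) :
  (forall x, P (cls R (TGen x))) -> P 0 ->
  (forall a b, P a -> P b -> P (a + b)) ->
  (forall k a, P a -> P (k *: a)) ->
  (forall a b, P a -> P b -> P (a * b)%g) ->
  forall a, P a.
Proof.
move=> Pg P0 PD PZ PM; elim/cls_ind; elim=> [x||s IHs|s IHs t IHt|k s IHs|s IHs t IHt].
- exact: Pg.
- exact: P0.
- by rewrite clsN -scaleN1r; exact: PZ.
- by rewrite clsD; exact: PD.
- by rewrite clsZ; exact: PZ.
- by rewrite clsM; exact: PM.
Qed.

End PresentedTheory.

(** * Normal forms and zero divisors *)

Section Rose.
Variables (K : fieldType) (E : wgraph) (v : vertex E).
Hypothesis Ev : forall u : vertex E, u = v.

Local Notation A := (wLPA K E).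
Local Notation U := (nat + edge E)%type.

Definition edges : seq (edge E) := fset_set (out_edges v).

Lemma mem_edges (e : edge E) : e \in edges.
Proof.
by rewrite /edges in_fset_set ?inE /out_edges /=; [exact: Ev|exact: row_finite].
Qed.

Lemma edges_uniq : uniq edges. Proof. exact: fset_uniq. Qed.

Lemma wt_le_vwt (e : edge E) : (wt e <= vwt v)%N.
Proof. by rewrite /vwt; apply: leq_bigmax_seq => //; exact: mem_edges. Qed.

(* The generators are indexed by pairs of adjacent elements of [U], whose
   elements [inl i] and [inr e] are the rows and the columns of the matrices
   [(e_i)] and [(e_i^* )]: this treats relations (iii) and (iv) uniformly. *)
Definition adj (a c : U) : bool :=
  match a, c with
  | inl i, inr e | inr e, inl i => (i < wt e)%N
  | _, _ => false
  end.

(** The summation range in (iii) and (iv). It may contain elements not adjacent to [a], in line with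
    the convention that the corresponding letters are zero. *)
Definition opposite (a : U) : seq U :=
  if a is inl _ then [seq inr e | e <- edges] else [seq inl i | i <- index_iota 0 (vwt v)].

(** The pairs that index (iii), where both rows are below the maximal weight, and (iv). *)
Definition kin (a b : U) : bool :=
  match a, b with
  | inl i, inl j => (i < vwt v)%N && (j < vwt v)%N
  | inr _, inr _ => true
  | _, _ => false
  end.

Lemma adjC a c : adj a c = adj c a.
Proof. by case: a c => [i|e] [j|f]. Qed.

Lemma adj_opposite a c : adj a c -> c \in opposite a.
Proof.
case: a c => [i|e] [j|f] //= h; first by rewrite map_f ?mem_edges.
by rewrite mem_map ?mem_index_iota ?(leq_trans h (wt_le_vwt _)) // => x y [].
Qed.

Lemma opposite_uniq a : uniq (opposite a).
Proof.
by case: a => [i|e] /=; rewrite map_inj_uniq ?edges_uniq ?iota_uniq // => x y [].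
Qed.

Lemma kin_adj a b c : adj a c -> adj c b -> kin a b.
Proof.
case: a b c => [i|e] [j|f] [k|g] //= h1 h2.
by rewrite (leq_trans h1 (wt_le_vwt _)) (leq_trans h2 (wt_le_vwt _)).
Qed.

Lemma kin_opposite a b : kin a b -> opposite a = opposite b.
Proof. by case: a b => [i|e] [j|f]. Qed.

Lemma kinC a b : kin a b = kin b a.
Proof. by case: a b => [i|e] [j|f] //=; rewrite andbC. Qed.

Definition runit : A := cls (@wLPA_rel K E) (w_vertex K v).

Definition letter (a c : U) : A :=
  match a, c with
  | inl i, inr e => cls (@wLPA_rel K E) (w_edge K e i)
  | inr e, inl i => cls (@wLPA_rel K E) (w_ghost K e i)
  | _, _ => 0
  end.

Lemma letter_nadj a c : ~~ adj a c -> letter a c = 0.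
Proof.
by case: a c => [i|e] [j|f] //= h; rewrite /w_edge /w_ghost insubN.
Qed.

Lemma letter_rel a b : kin a b ->
  \sum_(c <- opposite a) (letter a c * letter c b)%g = if a == b then runit else 0.
Proof.
case: a b => [i|e] [j|f] //=.
- case/andP=> hi hj; rewrite big_map /=.
  have /cong_rel/clsP := @wLPA_edge_ghost K E v (Ordinal hi) (Ordinal hj).
  rewrite cls_sum -(inj_eq val_inj) /= => h.
  under eq_bigr do rewrite -clsM.
  rewrite h -[inl i == _]/(i == j); by case: ifP.
- move=> _; rewrite big_map.
  have /cong_rel/clsP := wLPA_ghost_edge K (Ev (src e)) (Ev (src f)).
  rewrite cls_sum (Ev (rng e)) => h.
  rewrite big_mkord /=.
  under eq_bigr do rewrite -clsM.
  rewrite h -[inr e == _]/(e == f); by case: ifP.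
Qed.

Lemma runit_letter a c : (runit * letter a c)%g = letter a c.
Proof.
case: (boolP (adj a c)) => [|/letter_nadj ->]; last exact: numul0r.
case: a c => [i|e] [j|f] //= h; rewrite /runit -clsM; apply/clsP/cong_rel.
- by have := wLPA_src_edge K (Ordinal h); rewrite (Ev (src f)).
- by have := wLPA_rng_ghost K (Ordinal h); rewrite (Ev (rng e)).
Qed.

Lemma letter_runit a c : (letter a c * runit)%g = letter a c.
Proof.
case: (boolP (adj a c)) => [|/letter_nadj ->]; last exact: numul0l.
case: a c => [i|e] [j|f] //= h; rewrite /runit -clsM; apply/clsP/cong_rel.
- by have := wLPA_edge_rng K (Ordinal h); rewrite (Ev (rng f)).
- by have := wLPA_ghost_src K (Ordinal h); rewrite (Ev (src e)).
Qed.

Lemma runit_runit : (runit * runit)%g = runit.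
Proof.
rewrite /runit -clsM; apply/clsP/cong_rel.
by have := wLPA_vertex K v v; rewrite eqxx.
Qed.

Lemma gen_cases (P : A -> Prop) : P runit -> (forall a c, adj a c -> P (letter a c)) ->
  forall g, P (cls (@wLPA_rel K E) (TGen g)).
Proof.
move=> P1 Pl [u|e i|e i]; first by rewrite (Ev u).
- have := Pl (inl (i : nat)) (inr e) (ltn_ord i).
  by rewrite /= /w_edge; case: insubP => [j _ /val_inj ->|]; rewrite ?ltn_ord.
- have := Pl (inr e) (inl (i : nat)) (ltn_ord i).
  by rewrite /= /w_ghost; case: insubP => [j _ /val_inj ->|]; rewrite ?ltn_ord.
Qed.

Lemma rose_ind (P : A -> Prop) :
  P runit -> (forall a c, adj a c -> P (letter a c)) -> P 0 ->
  (forall a b, P a -> P b -> P (a + b)) ->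
  (forall k a, P a -> P (k *: a)) ->
  (forall a b, P a -> P b -> P (a * b)%g) ->
  forall a, P a.
Proof. by move=> P1 Pl P0 PD PZ PM; apply: presented_ind => //; exact: gen_cases. Qed.

Lemma runit_mul (a : A) : (runit * a)%g = a.
Proof.
elim/rose_ind: a => [|a c _||a b IHa IHb|k a IHa|a b IHa IHb].
- exact: runit_runit.
- exact: runit_letter.
- exact: numul0r.
- by rewrite numulDr IHa IHb.
- by rewrite -nuscaleAr IHa.
- by rewrite mulgA IHa.
Qed.

Lemma mul_runit (a : A) : (a * runit)%g = a.
Proof.
elim/rose_ind: a => [|a c _||a b IHa IHb|k a IHa|a b IHa IHb].
- exact: runit_runit.
- exact: letter_runit.
- exact: numul0l.
- by rewrite numulDl IHa IHb.
- by rewrite -nuscaleAl IHa.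
- by rewrite -mulgA IHb.
Qed.

Section Representation.
(** [P] is the action of the vertex: only an idempotent is asked for, as it will be a projection on
    functions of words. The operators [r a c] are constrained for adjacent pairs only, the other
    letters being zero. *)
Variables (V : lmodType K) (P : {linear V -> V}) (r : U -> U -> {linear V -> V}).
Hypotheses (PP : forall u, P (P u) = P u)
  (Pr : forall a c u, adj a c -> P (r a c u) = r a c u)
  (rP : forall a c u, adj a c -> r a c (P u) = r a c u)
  (r_rel : forall a b u, kin a b ->
    \sum_(c <- opposite a | adj a c && adj c b) r a c (r c b u) = if a == b then P u else 0).

Definition rose_rep (g : wLPA_gen E) : {linear V -> V} :=
  match g with
  | WVertex _ => P
  | WEdge e i => r (inl (i : nat)) (inr e)
  | WGhost e i => r (inr e) (inl (i : nat))
  end.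

Lemma ev_w_edge (e : edge E) i u :
  ev rose_rep (w_edge K e i) u = if (i < wt e)%N then r (inl i) (inr e) u else 0.
Proof. by rewrite /w_edge; case: insubP => [j -> <-|/negbTE ->]. Qed.

Lemma ev_w_ghost (e : edge E) i u :
  ev rose_rep (w_ghost K e i) u = if (i < wt e)%N then r (inr e) (inl i) u else 0.
Proof. by rewrite /w_ghost; case: insubP => [j -> <-|/negbTE ->]. Qed.

Lemma rose_repP s t : @wLPA_rel K E s t -> ev rose_rep s =1 ev rose_rep t.
Proof.
case=> {s t} [u w|e i|e i|e i|e i|w i j|w e f _ _] x.
- by rewrite (Ev u) (Ev w) eqxx /= PP.
- by rewrite /= !ev_w_edge ltn_ord Pr //= ltn_ord.
- by rewrite /= !ev_w_edge ltn_ord rP //= ltn_ord.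
- by rewrite /= !ev_w_ghost ltn_ord Pr //= ltn_ord.
- by rewrite /= !ev_w_ghost ltn_ord rP //= ltn_ord.
- have hw := Ev w; subst w.
  have := @r_rel (inl (i : nat)) (inl (j : nat)) x.
  rewrite /= !ltn_ord => /(_ isT); rewrite big_map ev_sum big_mkcond /= => h.
  transitivity (if (i : nat) == j then P x else 0); last first.
    by rewrite -[(i : nat) == j]/(i == j); case: (i == j).
  rewrite -h; apply: eq_bigr => e _ /=.
  rewrite ev_w_ghost; case: (j < _)%N; rewrite ?andbF ?linear0 // andbT.
  by rewrite ev_w_edge.
- have hw := Ev w; subst w.
  have := @r_rel (inr e) (inr f) x isT.
  rewrite /= big_map ev_sum big_mkcond /= => h.
  transitivity (if e == f then P x else 0); last by case: (e == f).
  rewrite -[e == f]/(inr e == inr f :> U) -h.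
  rewrite big_mkord; apply: eq_bigr => i _ /=.
  rewrite ev_w_edge; case: (i < wt f)%N; rewrite ?andbF ?linear0 // andbT.
  by rewrite ev_w_ghost.
Qed.

Lemma act_letter a c u : act rose_rep (letter a c) u = if adj a c then r a c u else 0.
Proof.
case: a c => [i|e] [j|f] /=; rewrite ?(act0 rose_repP) //.
- by rewrite (act_cls rose_repP) ev_w_edge.
- by rewrite (act_cls rose_repP) ev_w_ghost.
Qed.

Lemma act_runit u : act rose_rep runit u = P u.
Proof. by rewrite (act_cls rose_repP). Qed.

End Representation.
End Rose.

(** * Normal words as a basis, and leading coefficients of products *)

Section NormalForms.
Variables (K : fieldType) (E : wgraph) (v : vertex E).
Hypothesis Ev : forall u : vertex E, u = v.
Hypothesis wt_ge2 : forall e : edge E, (2 <= wt e)%N.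
Variables e0 e1 : edge E.
Hypotheses (e01 : e0 <> e1) (wt_e0 : wt e0 = vwt v) (wt_e1 : wt e1 = vwt v).

Local Notation A := (wLPA K E).
Local Notation U := (nat + edge E)%type.
Local Notation word := (seq (U * U)).
Local Notation V := (word -> K^o).
Local Notation opposite := (opposite v).
Local Notation kin := (kin v).
Local Notation runit := (runit K v).
Local Notation letter := (@letter K E).

(* Normal words are the words without factor [(a, special a) (special a, b)];
   [special' a] is a second element adjacent to every element akin to [a]. *)
Definition special (a : U) : U := if a is inl _ then inr e0 else inl 0%N.
Definition special' (a : U) : U := if a is inl _ then inr e1 else inl 1%N.

Lemma sp_neq a : special' a != special a.
Proof. by case: a => [i|e] //; apply/eqP => -[] /esym. Qed.

Lemma kin_sp a b : kin a b -> special a = special b.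
Proof. by case: a b => [i|e] [j|f]. Qed.

(** Every row meets [e0], whose weight is maximal, and every edge meets row 0. For [special'] the
    same is said of [e1] and row 1, which takes weights at least 2. *)
Lemma adj_sp a b : kin a b -> adj a (special a).
Proof.
case: a b => [i|e] [j|f] //=; first by rewrite wt_e0 => /andP[].
by move=> _; apply: leq_trans (wt_ge2 e).
Qed.

Lemma adj_sp' a b : kin a b -> adj a (special' a).
Proof. by case: a b => [i|e] [j|f] //=; rewrite wt_e1 => /andP[]. Qed.

(* Words are stored in reverse order: the head is the last letter, and
   [free w a] tells that [w] may be followed by a letter [(a, _)]. *)
Definition free (w : word) (a : U) : bool :=
  if w is g :: _ then ~~ ((g.2 == a) && (a == special g.1)) else true.

Fixpoint normal (w : word) : bool :=
  if w is g :: w' then [&& adj g.1 g.2, free w' g.1 & normal w'] else true.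

(** The unit acts as this projection, which allows functions on all words to be used instead of a
    type of normal words. *)
Definition proj (F : V) : V := fun w => if normal w then F w else 0.

(* The transpose of right multiplication by [(a, c)] on normal words.  A factor
   [(p, a) (a, c)] with [a = special p] is replaced by factors [(p, q) (q, c)]; the
   result is normal, as [free] only looks at the first entry [p]. *)
Definition step (a c : U) (F : V) : V := fun w =>
  if ~~ (normal w && adj a c) then 0
  else if free w a then F ((a, c) :: w)
  else if w is g :: w' then
    (if g.1 == c then F w' else 0) -
    \sum_(q <- opposite g.1 | [&& q != a, adj g.1 q & adj q c])
       F ((q, c) :: (g.1, q) :: w')
  else 0.

Lemma proj_is_linear : linear proj.
Proof.
move=> k F G; apply/funext=> w.
rewrite -[RHS]/(k *: proj F w + proj G w) /proj.
by case: ifP => // _; rewrite scaler0 addr0.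
Qed.
HB.instance Definition _ := GRing.isLinear.Build K V V *:%R proj proj_is_linear.

Lemma step_is_linear a c : linear (step a c).
Proof.
move=> k F G; apply/funext=> w.
rewrite -[RHS]/(k *: step a c F w + step a c G w) /step.
case: ifP => _; first by rewrite scaler0 addr0.
case: ifP => [_ //|_]; case: w => [|g w]; first by rewrite scaler0 addr0.
rewrite big_split -scaler_sumr /= scalerBr opprD addrACA; congr (_ + _).
by case: ifP => // _; rewrite scaler0 addr0.
Qed.
HB.instance Definition _ a c :=
  GRing.isLinear.Build K V V *:%R (step a c) (step_is_linear a c).

Lemma step_free a c F w :
  normal w -> adj a c -> free w a -> step a c F w = F ((a, c) :: w).
Proof. by rewrite /step => -> -> ->. Qed.

Lemma step_forb a c F p w : normal ((p, a) :: w) -> adj a c -> a = special p ->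
  step a c F ((p, a) :: w) =
  (if p == c then F w else 0) -
  \sum_(q <- opposite p | [&& q != a, adj p q & adj q c]) F ((q, c) :: (p, q) :: w).
Proof.
by move=> nw ac ap; rewrite /step nw ac [free _ _]/= -ap eqxx.
Qed.

Lemma normal_alt p a c q w : normal ((p, a) :: w) ->
  q != special p -> adj p q -> adj q c -> normal ((q, c) :: (p, q) :: w).
Proof. by move=> /= /and3P[_ -> ->] /negbTE -> -> ->; rewrite andbF. Qed.

Lemma stepP a c F w : proj (step a c F) w = step a c F w.
Proof. by rewrite /proj /step; case: (normal w). Qed.

Lemma step_proj a c F w : step a c (proj F) w = step a c F w.
Proof.
rewrite /step; case: (boolP (normal w)) => //= nw.
case: (boolP (adj a c)) => //= ac.
case: ifP => [fr|]; first by rewrite /proj /= ac fr nw.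
case: w nw => // -[p q] w nw /= /negbFE /andP[/eqP qa ap].
subst q; congr (_ - _).
  by rewrite /proj; case: ifP => // _; move: nw => /= /and3P[_ _ ->].
apply: eq_bigr => q /and3P[qa pq qc].
by rewrite /proj (normal_alt nw) // -(eqP ap).
Qed.

(** Only the summand of [c = special a] is rewritten. It yields the right-hand side minus the words
    of all other [c], and these are exactly the remaining summands. *)
Lemma step_rel_free a b F w : kin a b -> normal w -> free w a ->
  \sum_(c <- opposite a | adj a c && adj c b) step a c (step c b F) w =
  if a == b then F w else 0.
Proof.
move=> ab nw fr.
have as_ := adj_sp ab; have sb : adj (special a) b.
  by rewrite (kin_sp ab) adjC; apply: (@adj_sp _ a); rewrite kinC.
rewrite big_mkcond (bigD1_seq (special a)) ?opposite_uniq ?(adj_opposite Ev) //=.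
rewrite as_ sb -big_mkcondr step_free // step_forb //; last by rewrite /= as_ fr nw.
rewrite -addrA [X in _ + X](_ : _ = 0) ?addr0 //.
rewrite addrC -sumrB big1 // => c /and3P[ca ac cb].
rewrite step_free // step_free ?subrr //=; first by rewrite ac fr nw.
by rewrite eqxx /= ca.
Qed.

(** What is left after the free case is the overlap of two forbidden factors: a word ending in
    [(p, a)] with [a = special p]. *)
Lemma step_rel a b F : kin a b ->
  \sum_(c <- opposite a | adj a c && adj c b) step a c (step c b F) =
  if a == b then proj F else 0.
Proof.
move=> ab; apply/funext=> w.
rewrite (_ : (\sum_(c <- _ | _) _) w =
   \sum_(c <- opposite a | adj a c && adj c b) step a c (step c b F) w); last first.
  by elim/big_rec2: _ => // c x y _ <-.
rewrite (_ : (if _ then _ else _) w = if a == b then proj F w else 0); last first.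
  by case: ifP.
have [nw|nw] := boolP (normal w); last first.
  rewrite big1 /proj ?(negbTE nw) ?if_same // => c _.
  by rewrite /step (negbTE nw).
have [fr|] := boolP (free w a); first by rewrite step_rel_free // /proj nw.
rewrite /proj nw; case: w nw => // -[p q] w nw /= /negPn /andP[/eqP qa /eqP ap].
subst q.
have pa : adj p a by case/and3P: nw.
have spa : special p = a by [].
under eq_bigr => c /andP[ac cb] do rewrite step_forb //.
have kin_p c : adj a c -> kin p c by move=> ac; apply: (kin_adj Ev pa ac).
rewrite sumrB.
(* Contracting [(p, a) (a, c)] to the unit happens for [c = p] only. *)
have -> : \sum_(c <- opposite a | adj a c && adj c b) (if p == c then step c b F w else 0)
   = if adj p b then step p b F w else 0.
  rewrite -big_mkcondr /=.
  case: (boolP (adj p b)) => pb.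
    rewrite (big_rem p) /= ?(adj_opposite Ev) 1?adjC ?pa ?pb ?eqxx //=.
    rewrite big1_seq ?addr0 // => c /andP[/andP[_ /eqP <-]].
    by rewrite mem_rem_uniq ?opposite_uniq // !inE eqxx.
  by rewrite big1 // => c /andP[/andP[_ cb] /eqP pc]; rewrite pc cb in pb.
rewrite (exchange_big_dep (fun q => (q != a) && adj p q)) /=; last first.
  by move=> c q _ /and3P[-> ->].
(* For fixed [q] the sum over [c] is the relation at [(p, q) :: w]. Since [q] differs from
   [special p], this word may be followed by [q], and the free case applies. *)
have alt q : (q != a) && adj p q ->
   \sum_(c <- opposite a | adj a c && adj c b && [&& q != a, adj p q & adj q c])
     step c b F ((q, c) :: (p, q) :: w) = if q == b then F ((p, q) :: w) else 0.
  move=> /andP[qa pq].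
  have aq : kin a q by apply: (kin_adj Ev _ pq); rewrite adjC.
  have qb : kin q b.
    by case: (a) (q) (b) aq ab => [?|?] [?|?] [?|?] //= /andP[_ ->] /andP[_ ->].
  rewrite -(step_rel_free F qb (w := (p, q) :: w)); last 2 first.
  - by rewrite /= pq; move: nw => /= /and3P[_ -> ->].
  - by rewrite /= eqxx /= spa.
  rewrite (kin_opposite aq) big_mkcond [RHS]big_mkcond; apply: eq_bigr => c _.
  (* Here [adj a c] is automatic: [c] is akin to [p], so [a] is also [special c]. *)
  have -> : adj a c && adj c b && [&& q != a, adj p q & adj q c] = adj q c && adj c b.
    rewrite qa pq /= -andbA andbA [_ && adj q c]andbC !andbA andbC.
    case: (boolP (adj q c)) => //= qc; rewrite ?andbF ?andbT //.
    rewrite [adj a c](_ : _ = true) ?andbT // ap adjC.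
    have pc : kin p c by apply: (kin_adj Ev pq qc).
    rewrite (kin_sp pc).
    by apply: (@adj_sp _ p); rewrite kinC.
  case: ifP => // /andP[qc cb]; rewrite [RHS]step_free //=.
    by rewrite pq; move: nw => /= /and3P[_ -> ->].
  by rewrite /= eqxx spa qa.
rewrite (eq_bigr _ alt) -big_mkcondr /=.
case: (boolP (adj p b)) => pb; last first.
  rewrite big1 ?subr0; last by move=> q /andP[/andP[_ pq] /eqP qb]; rewrite -qb pq in pb.
  by case: eqP => // eab; rewrite -eab pa in pb.
have -> : step p b F w = F ((p, b) :: w).
  by move: nw => /= /and3P[_ fr nw]; rewrite step_free.
(* The double sum omits [q = a]. So [F ((p, b) :: w)] survives for [b = a] and cancels otherwise. *)
case: (altP (a =P b)) => [<-|nab].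
  rewrite big1 ?subr0 // => q /andP[/andP[qa _] /eqP qa']; by rewrite qa' eqxx in qa.
rewrite (big_rem b) /= ?(adj_opposite Ev) ?pb ?eqxx 1?eq_sym ?nab //=.
rewrite big1_seq ?addr0 ?subrr // => q /andP[/andP[_ /eqP ->]].
by rewrite mem_rem_uniq ?opposite_uniq // !inE eqxx.
Qed.

Definition word_rep : wLPA_gen E -> {linear V -> V} := rose_rep proj step.

Lemma projK (F : V) : proj (proj F) = proj F.
Proof. by apply/funext=> w; rewrite /proj; case: (normal w). Qed.

Lemma proj_stepE a c (F : V) : adj a c -> proj (step a c F) = step a c F.
Proof. by move=> _; apply/funext=> w; exact: stepP. Qed.

Lemma step_projE a c (F : V) : adj a c -> step a c (proj F) = step a c F.
Proof. by move=> _; apply/funext=> w; exact: step_proj. Qed.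

Lemma word_repP s t : @wLPA_rel K E s t -> ev word_rep s =1 ev word_rep t.
Proof.
exact: (rose_repP Ev projK proj_stepE step_projE (fun a b F => @step_rel a b F)).
Qed.

Local Notation Act a := (act word_rep (a : A)).

Lemma act_word_letter a c F : adj a c -> Act (letter a c) F = step a c F.
Proof.
move=> ac.
by rewrite (act_letter Ev projK proj_stepE step_projE (fun a b F => @step_rel a b F)) ac.
Qed.

Fixpoint mon (w : word) : A :=
  if w is g :: w' then (mon w' * letter g.1 g.2)%g else runit.

Lemma mon_cat x y : mon (x ++ y) = (mon y * mon x)%g.
Proof. by elim: x => [|g x IH] /=; rewrite ?(mul_runit Ev) // IH mulgA. Qed.

Lemma act_mon_cons g w F : adj g.1 g.2 ->
  Act (mon (g :: w)) F = Act (mon w) (step g.1 g.2 F).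
Proof. by move=> ad; rewrite /= (actM word_repP) act_word_letter. Qed.

Definition spanned (x : A) : Prop := exists s : seq (K * word),
  all (fun p => normal p.2) s /\ x = \sum_(p <- s) p.1 *: mon p.2.

Lemma spanned0 : spanned 0.
Proof. by exists [::]; rewrite big_nil. Qed.

Lemma spannedD x y : spanned x -> spanned y -> spanned (x + y).
Proof.
by move=> [s [ns ->]] [t [nt ->]]; exists (s ++ t); rewrite all_cat ns nt big_cat.
Qed.

Lemma spannedZ k x : spanned x -> spanned (k *: x).
Proof.
move=> [s [ns ->]]; exists [seq (k * p.1, p.2) | p <- s]; split.
  by rewrite all_map; apply: sub_all ns.
by rewrite big_map scaler_sumr; apply: eq_bigr => p _; rewrite scalerA.
Qed.

Lemma spanned_mon w : normal w -> spanned (mon w).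
Proof. by move=> nw; exists [:: (1, w)]; rewrite /= nw big_seq1 scale1r. Qed.

(** One rewriting suffices: the relation at [p] and [c] replaces a forbidden factor by the unit or
    zero minus factors through [q <> a], and these leave the word normal. *)
Lemma mon_letter w a c : normal w -> adj a c -> spanned (mon w * letter a c)%g.
Proof.
move=> nw ac; have [fr|] := boolP (free w a).
  by rewrite -[(_ * _)%g]/(mon ((a, c) :: w)); apply: spanned_mon; rewrite /= ac fr nw.
case: w nw => // -[p q] w nw /= /negPn /andP[/eqP qa /eqP ap]; subst q.
have [pa _ nw'] := and3P nw; have pc := kin_adj Ev pa ac.
rewrite -mulgA.
have -> : (letter p a * letter a c)%g = (if p == c then runit else 0)
    - \sum_(q <- opposite p | q != a) (letter p q * letter q c)%g.
  rewrite -(letter_rel K Ev pc) (bigD1_seq a) ?opposite_uniq ?(adj_opposite Ev) //=.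
  by rewrite addrK.
rewrite numulDr numulNr -scaleN1r; apply/spannedD/spannedZ.
  case: eqP => _; last by rewrite numul0r; exact: spanned0.
  by rewrite (mul_runit Ev); exact: spanned_mon.
rewrite numul_sumr; elim/big_rec: _ => [|q x qa sx]; first exact: spanned0.
apply: spannedD sx; have [pq|/letter_nadj ->] := boolP (adj p q); last first.
  by rewrite numul0l numul0r; exact: spanned0.
have [qc|/letter_nadj ->] := boolP (adj q c); last first.
  by rewrite !numul0r; exact: spanned0.
rewrite mulgA -[(_ * _)%g]/(mon ((q, c) :: (p, q) :: w)); apply: spanned_mon.
by apply: normal_alt nw _ pq qc; rewrite -ap.
Qed.

Lemma spanned_letter x a c : spanned x -> adj a c -> spanned (x * letter a c)%g.
Proof.
move=> [s [ns ->]] ac; rewrite numul_suml; elim: s ns => [_|p s IH /= /andP[np ns]].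
  by rewrite big_nil; exact: spanned0.
rewrite big_cons; apply: spannedD; last exact: IH.
by rewrite -nuscaleAl; apply/spannedZ/mon_letter.
Qed.

Lemma spannedP x : spanned x.
Proof.
(* Stability under right multiplication is what passes through products in the induction; [y] is
   then taken to be the unit. *)
suff H : forall y, spanned y -> spanned (y * x)%g.
  by rewrite -(runit_mul Ev x); apply/H/(@spanned_mon [::]).
elim/(@rose_ind K E v Ev): x => [|a c ac||a b IHa IHb|k a IHa|a b IHa IHb] y sy.
- by rewrite (mul_runit Ev).
- exact: spanned_letter.
- by rewrite numul0r; exact: spanned0.
- by rewrite numulDr; apply: spannedD; [exact: IHa|exact: IHb].
- by rewrite -nuscaleAr; apply/spannedZ/IHa.
- by rewrite mulgA; apply/IHb/IHa.
Qed.

(** Which letters may follow [(a, c)] depends on [c] and [special a] alone, and akin elements have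
    the same special element. *)
Lemma normal_glue (y : word) a q c w : normal (y ++ [:: (a, c)]) ->
  normal ((q, c) :: w) -> kin a q -> normal (y ++ (q, c) :: w).
Proof.
move=> + nw aq; elim: y => [//|g y IH] /= /and3P[-> fr ny]; rewrite IH // andbT /=.
by case: y fr {IH ny} => [|h y] //=; rewrite (kin_sp aq).
Qed.

Lemma normal_catl (x y : word) : normal (x ++ y) -> normal x.
Proof.
elim: x => [//|g x IH] /= /and3P[-> fr /IH ->]; rewrite andbT.
by case: x fr {IH}.
Qed.

Lemma normal_catr (x y : word) : normal (x ++ y) -> normal y.
Proof. by elim: x => [//|g x IH] /= /and3P[_ _ /IH]. Qed.

(** Transposed, this says that the product of [w] and [y] needs no rewriting if their concatenation
    is normal. *)
Lemma act_mon_glue y F w : normal (y ++ w) -> Act (mon y) F w = F (y ++ w).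
Proof.
elim: y F => [|g y IH] F nyw.
  by rewrite /= (act_runit Ev projK proj_stepE step_projE step_rel) /= /proj nyw.
move: nyw => /= /and3P[ad fr nyw]; rewrite act_mon_cons //.
by rewrite IH // step_free // -surjective_pairing.
Qed.

(** Rewriting never lengthens a word, so the product of [w] and [y] involves no word of length [s]
    or more. *)
Lemma act_mon_short s y F w : (forall x, (size x < s)%N -> F x = 0) ->
  normal y -> (size w + size y < s)%N -> Act (mon y) F w = 0.
Proof.
elim: y s F => [|g y IH] s F Fs ny ws.
  rewrite /= (act_runit Ev projK proj_stepE step_projE step_rel) /= /proj.
  by rewrite Fs ?if_same //; lia.
move: ny => /= /and3P[ad fr ny]; rewrite act_mon_cons // (IH s.-1) //=; last first.
  by move: ws => /=; lia.
move=> x xs; rewrite /step; case: ifP => // _; case: ifP => _.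
  by apply: Fs => /=; lia.
case: x xs => // -[p q] x /= xs; rewrite Fs ?if_same ?sub0r; last by lia.
by rewrite big1 ?oppr0 // => r _; apply: Fs => /=; lia.
Qed.

Definition delta (z : word) : V := fun w => (w == z)%:R.

(** The action transposes right multiplication; hence this is the coordinate at [w] of the empty
    word multiplied by [x], that is, of [x] itself. *)
Definition coef (x : A) (w : word) : K := Act x (delta w) [::].

(** The functional [coef] reads off the coefficients of any combination of normal words, so these
    are linearly independent as well as spanning. [T] is the support of [x]. *)
Lemma expansion x : exists T : seq word,
  [/\ uniq T, all normal T, (forall w, (coef x w != 0) = (w \in T)) &
      x = \sum_(w <- T) coef x w *: mon w].
Proof.
have [s [ns xE]] := spannedP x.
have cE w : coef x w = \sum_(p <- s | p.2 == w) p.1.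
  rewrite /coef xE (act_sum word_repP).
  have -> : (\sum_(p <- s) Act (p.1 *: mon p.2) (delta w)) [::]
      = \sum_(p <- s) Act (p.1 *: mon p.2) (delta w) [::].
    by elim/big_rec2: _ => // p F G _ <-.
  rewrite [RHS]big_mkcond; apply: eq_big_seq => p /(allP ns) np.
  rewrite (actZ word_repP) -[LHS]/(p.1 * Act (mon p.2) (delta w) [::]).
  rewrite act_mon_glue ?cats0 // /delta.
  by case: eqP; rewrite ?mulr1 ?mulr0.
pose T := [seq w <- undup [seq p.2 | p <- s] | coef x w != 0].
have uT : uniq T by rewrite filter_uniq ?undup_uniq.
have memT w : (coef x w != 0) = (w \in T).
  rewrite mem_filter mem_undup; case: (boolP (coef x w != 0)) => //= nz.
  apply/esym; apply: contraNT nz => nw; rewrite cE big1_seq // => p /andP[/eqP pw ps].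
  by rewrite -pw map_f in nw.
exists T; split => //.
  apply/allP => w; rewrite mem_filter mem_undup => /andP[_ /mapP[p ps ->]].
  exact: (allP ns).
rewrite big_filter big_mkcond /= [LHS]xE.
rewrite [RHS](eq_bigr (fun w => \sum_(p <- s | p.2 == w) p.1 *: mon p.2)); last first.
  move=> w _; transitivity (coef x w *: mon w).
    by case: eqP => //= ->; rewrite scale0r.
  by rewrite cE scaler_suml; apply: eq_bigr => p /eqP <-.
rewrite (exchange_big_dep predT) //= [LHS]big_seq [RHS]big_seq; apply: eq_bigr => p ps.
have pu : p.2 \in undup [seq p.2 | p <- s] by rewrite mem_undup map_f.
rewrite big_mkcond (bigD1_seq p.2) ?undup_uniq //= eqxx big1 ?addr0 // => w.
by rewrite eq_sym => /negbTE ->.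
Qed.

Lemma sum_coef (x : A) (T : seq word) w : uniq T ->
  (forall w, (coef x w != 0) = (w \in T)) ->
  \sum_(w' <- T) coef x w' * (w' == w)%:R = coef x w.
Proof.
move=> uT memT; have [wT|wT] := boolP (w \in T).
  by rewrite (bigD1_seq w) //= eqxx mulr1 big1 ?addr0 // => i /negbTE ->; rewrite mulr0.
rewrite big1_seq => [|i /= iT]; last first.
  by case: eqP => [iw|]; rewrite ?mulr0 //; rewrite -iw iT in wT.
by apply/esym/eqP; apply: contraNT wT; rewrite memT.
Qed.

Lemma delta_glue (y0 w0 y w : word) h1 h2 g1 g2 : size y = size y0 ->
  delta (y0 ++ h1 :: h2 :: w0) (y ++ g1 :: g2 :: w) =
  [&& y == y0, g1 == h1, g2 == h2 & w == w0]%:R.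
Proof. by move=> yy0; rewrite /delta eqseq_cat // !eqseq_cons. Qed.

(** A word of the top length [p + q + 2] arises from [w] and [y] either as their concatenation or,
    if the letters at the junction form the forbidden factor [(a, special a) (special a, b)], as one
    of its replacements [(a, c) (c, b)], with coefficient -1. *)
Lemma junction p q (y0 w0 y w : word) a c c' b :
  normal (y0 ++ (c', b) :: (a, c) :: w0) -> normal y -> normal w ->
  size w0 = p -> size y0 = q -> (size w <= p.+1)%N -> (size y <= q.+1)%N ->
  Act (mon y) (delta (y0 ++ (c', b) :: (a, c) :: w0)) w =
    (w == (a, c) :: w0)%:R * (y == y0 ++ [:: (c', b)])%:R
    - (if (c == c') && (c != special a) then
        (w == (a, special a) :: w0)%:R * (y == y0 ++ [:: (special a, b)])%:R else 0).
Proof.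
set z := y0 ++ _ => nz ny nw sw0 sy0 swp syq.
have short_delta x : (size x < p + q + 2)%N -> delta z x = 0.
  by move=> xs; rewrite /delta; case: eqP => // xz; move: xs; rewrite xz size_cat /=; lia.
have [lt|ge] := ltnP (size w + size y)%N (p + q + 2).
  rewrite (act_mon_short short_delta) //.
  have neq c1 c2 : (w == (a, c1) :: w0)%:R * (y == y0 ++ [:: (c2, b)])%:R = 0 :> K.
    case: eqP => [ew|]; last by rewrite mul0r.
    case: eqP => [ey|]; last by rewrite mulr0.
    by move: lt; rewrite ew ey size_cat /=; lia.
  by rewrite !neq if_same subr0.
have sw : size w = p.+1 by lia.
have sy : size y = q.+1 by lia.
clear ge swp syq.
case: w sw nw => // -[p1 q1] w1 /= [sw1] nw.
(* By the reversed storage, the first letter of the word [y] is the last item of the list. *)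
case/lastP: y sy ny => // y1 [a2 b2]; rewrite size_rcons -cats1 => -[sy1] ny.
have ad2 : adj a2 b2.
  by move: (normal_catr ny) => /andP[].
rewrite mon_cat (actM word_repP) /= (runit_mul Ev) act_word_letter //.
have kin2 : kin a2 a2 by apply: (kin_adj Ev ad2); rewrite adjC.
have szy : size y1 = size y0 by lia.
have eqy c2 : (y1 ++ [:: (a2, b2)] == y0 ++ [:: (c2, b)]) =
    [&& y1 == y0, a2 == c2 & b2 == b].
  by rewrite eqseq_cat // eqseq_cons andbT.
have eqw c1 : ((p1, q1) :: w1 == (a, c1) :: w0) = [&& p1 == a, q1 == c1 & w1 == w0].
  by rewrite eqseq_cons -andbA.
rewrite !eqy !eqw.
have [fr|] := boolP (free ((p1, q1) :: w1) a2).
  rewrite step_free // act_mon_glue; last first.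
    by apply: (normal_glue ny) kin2; rewrite [normal _]/= ad2; apply/and3P.
  rewrite delta_glue //; move: fr => /= fr.
  (* A free junction is not of the form [(a, special a) (special a, b)]. *)
  rewrite [X in _ - X](_ : _ = 0) ?subr0; last first.
    case: ifP => // _.
    case: (altP (a2 =P special a)) => [ea|]; last by rewrite andbF mulr0.
    case: (altP (p1 =P a)) => [ep|]; last by rewrite mul0r.
    case: (altP (q1 =P special a)) => [eq1|]; last by rewrite mul0r.
    by move: fr; rewrite ep ea eq1 eqxx.
  rewrite -natrM mulnb !xpair_eqE; congr (_%:R).
  by case: (y1 == y0) (a2 == c') (b2 == b) (p1 == a) (q1 == c) (w1 == w0) => [] [] [] [] [] [].
move=> /= /negPn /andP[/eqP eq1 /eqP ea2]; subst q1.
rewrite step_forb //.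
(* Contracting the junction to the unit loses two letters, so the top length is missed. *)
rewrite (act_mon_short short_delta) ?if_same ?sub0r; last 2 first.
- exact: normal_catl ny.
- by lia.
have adz : [/\ adj a c, adj c' b & ~~ ((c == c') && (c' == special a))].
  by move: (normal_catr nz) => /= /and3P[-> -> /and3P[-> _ _]].
(* The concatenation is not normal and hence differs from [z]. *)
rewrite [X in X - _](_ : _ = 0); last first.
  case: (altP (p1 =P a)) => [ep|]; last by rewrite mul0r.
  case: (altP (a2 =P c)) => [ec|]; last by rewrite mul0r.
  case: (altP (a2 =P c')) => [ec'|]; last by rewrite andbF mulr0.
  by case: adz => _ _; rewrite -ec -ec' ea2 ep !eqxx.
rewrite sub0r; congr (- _).
have altE q0 : [&& q0 != a2, adj p1 q0 & adj q0 b2] ->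
   Act (mon y1) (delta z) ((q0, b2) :: (p1, q0) :: w1) =
   [&& y1 == y0, (q0, b2) == (c', b), (p1, q0) == (a, c) & w1 == w0]%:R.
  case/and3P=> qa pq qb; rewrite act_mon_glue ?delta_glue //.
  apply: (normal_glue ny); last by apply: (kin_adj Ev ad2); rewrite adjC.
  by apply: normal_alt nw _ pq qb; rewrite -ea2.
rewrite (eq_bigr _ altE) {altE}.
have [ep|nep] := eqVneq p1 a; last first.
  rewrite big1 => [|q0 _]; last by rewrite !xpair_eqE (negbTE nep) !andbF.
  by rewrite mul0r if_same.
have [eb|neb] := eqVneq b2 b; last first.
  rewrite big1 => [|q0 _]; last by rewrite !xpair_eqE (negbTE neb) !andbF.
  by rewrite !andbF mulr0 if_same.
have [ey|ney] := eqVneq y1 y0; last first.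
  by rewrite big1 // mulr0 if_same.
have [ew|new] := eqVneq w1 w0; last first.
  rewrite big1 => [|q0 _]; last by rewrite !andbF.
  by rewrite !andbF mul0r if_same.
subst p1 b2; rewrite -ea2 eqxx mulr1.
have [ec|nec] := eqVneq c c'; last first.
  rewrite big1 // => q0 _; rewrite !xpair_eqE.
  by case: eqP => //= ->; rewrite [c' == c]eq_sym (negbTE nec) !andbF.
case: adz => ac; rewrite -ec => cb nc.
have [eca|nca] := eqVneq c a2.
  by move: nc; rewrite eqxx /= eca ea2 eqxx.
rewrite (big_rem c) /= ?(adj_opposite Ev) // nca ac cb !xpair_eqE !eqxx.
rewrite big1_seq ?addr0 // => q0 /andP[_ ]; rewrite mem_rem_uniq ?opposite_uniq //.
by rewrite !inE !xpair_eqE => /andP[/negbTE -> _].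
Qed.

Lemma act_expand x (T : seq word) F w : x = \sum_(u <- T) coef x u *: mon u ->
  Act x F w = \sum_(u <- T) coef x u * Act (mon u) F w.
Proof.
move=> xE; rewrite [in LHS]xE (act_sum word_repP).
have -> : (\sum_(u <- T) Act (coef x u *: mon u) F) w
    = \sum_(u <- T) Act (coef x u *: mon u) F w.
  by elim/big_rec2: _ => // p G H _ <-.
by apply: eq_bigr => u _; rewrite (actZ word_repP).
Qed.

(** The bilinear extension of [junction]: each top coefficient of a product has one main term and at
    most one correction. *)
Lemma top_coef x y p q (y0 w0 : word) a c c' b :
  (forall w, coef x w != 0 -> (size w <= p.+1)%N) ->
  (forall w, coef y w != 0 -> (size w <= q.+1)%N) ->
  size w0 = p -> size y0 = q ->
  normal (y0 ++ (c', b) :: (a, c) :: w0) ->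
  coef (x * y)%g (y0 ++ (c', b) :: (a, c) :: w0) =
    coef x ((a, c) :: w0) * coef y (y0 ++ [:: (c', b)])
    - (if (c == c') && (c != special a) then
        coef x ((a, special a) :: w0) * coef y (y0 ++ [:: (special a, b)]) else 0).
Proof.
move=> xp yq sw0 sy0 nz; rewrite /coef (actM word_repP) -!/(coef _ _).
have [T [uT nT memT xE]] := expansion x.
have [S [uS nS memS yE]] := expansion y.
rewrite (act_expand _ _ xE).
rewrite (eq_big_seq (fun w => coef x w * \sum_(u <- S) coef y u *
   ((w == (a, c) :: w0)%:R * (u == y0 ++ [:: (c', b)])%:R
    - (if (c == c') && (c != special a) then
        (w == (a, special a) :: w0)%:R * (u == y0 ++ [:: (special a, b)])%:R else 0)))); last first.
  move=> w wT; rewrite act_mon_glue ?cats0; last exact: (allP nT).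
  rewrite (act_expand _ _ yE); congr (_ * _); apply: eq_big_seq => u uS'.
  rewrite (junction nz _ _ sw0 sy0) //; first exact: (allP nS).
  - exact: (allP nT).
  - by apply: xp; rewrite memT.
  - by apply: yq; rewrite memS.
have sums c1 c2 : \sum_(w <- T) coef x w * (\sum_(u <- S) coef y u *
     ((w == (a, c1) :: w0)%:R * (u == y0 ++ [:: (c2, b)])%:R)) =
   coef x ((a, c1) :: w0) * coef y (y0 ++ [:: (c2, b)]).
  rewrite -(sum_coef _ uT memT) -(sum_coef _ uS memS) mulr_suml.
  apply: eq_bigr => w _; rewrite -mulrA; congr (_ * _); rewrite mulr_sumr.
  by apply: eq_bigr => u _; rewrite mulrCA.
case: ifP => _; last first.
  rewrite subr0 -sums; apply: eq_bigr => w _; congr (_ * _).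
  by apply: eq_bigr => u _; rewrite subr0.
rewrite -!sums -sumrB; apply: eq_bigr => w _; rewrite -mulrBr -sumrB; congr (_ * _).
by apply: eq_bigr => u _; rewrite mulrBr.
Qed.

Lemma seq_argmax (T : eqType) (f : T -> nat) t s :
  exists2 w, w \in t :: s & forall u, u \in t :: s -> (f u <= f w)%N.
Proof.
elim: s t => [|t' s IH] t; first by exists t => [|u]; rewrite inE // => /eqP->.
have [w ws wmax] := IH t'; have [tw|wt] := leqP (f t) (f w).
  exists w => [|u]; rewrite inE ?ws ?orbT // => /predU1P[-> //|]; exact: wmax.
exists t => [|u]; rewrite inE ?eqxx // => /predU1P[-> //|/wmax uw].
exact: leq_trans uw (ltnW wt).
Qed.

Lemma leading_word x : x <> 0 -> exists w,
  [/\ coef x w != 0, normal w & forall u, coef x u != 0 -> (size u <= size w)%N].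
Proof.
move=> x0; have [T [uT nT memT xE]] := expansion x.
case: T uT nT memT xE => [|t T] uT nT memT xE; first by rewrite xE big_nil in x0.
have [w wT wmax] := seq_argmax size t T; exists w; split.
- by rewrite memT.
- exact: (allP nT).
- by move=> u; rewrite memT; exact: wmax.
Qed.

Lemma scalar_of_degree0 x : coef x [::] != 0 -> (forall u, coef x u != 0 -> (size u <= 0)%N) ->
  x = coef x [::] *: runit.
Proof.
move=> nz le; have [T [uT nT memT xE]] := expansion x; rewrite [LHS]xE.
rewrite (bigD1_seq [::]) //= -?memT // big1_seq ?addr0 // => w /andP[wn].
by rewrite -memT => /le; case: w wn.
Qed.

Lemma rose_domain (x y : A) : (x * y)%g = 0 -> x = 0 \/ y = 0.
Proof.
move=> xy0; have [->|/eqP x0] := eqVneq x 0; first by left.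
have [->|/eqP y0] := eqVneq y 0; [by right|exfalso].
have [[|[a c] w0] [cw nw lew]] := leading_word x0.
  have := scalar_of_degree0 cw lew => xE; apply: y0.
  move: xy0; rewrite xE -nuscaleAl (runit_mul Ev) => /eqP.
  by rewrite scaler_eq0 (negbTE cw) => /eqP.
have [u [cu nu leu]] := leading_word y0.
case/lastP: u cu nu leu => [|u0 [c1 b]] cu nu leu.
  have := scalar_of_degree0 cu leu => yE; apply: x0.
  move: xy0; rewrite yE -nuscaleAr (mul_runit Ev) => /eqP.
  by rewrite scaler_eq0 (negbTE cu) => /eqP.
rewrite -cats1 in cu nu leu.
have ac : adj a c by move: nw => /= /andP[].
have cb : adj c1 b.
  by move: (normal_catr nu) => /andP[].
have su d : size (u0 ++ [:: d]) = (size u0).+1 by rewrite size_cat addn1.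
have lew' w : coef x w != 0 -> (size w <= (size w0).+1)%N by move/lew.
have leu' w : coef y w != 0 -> (size w <= (size u0).+1)%N by move/leu; rewrite su.
have nz a' c' d : normal ((a', c') :: w0) -> kin c1 d -> adj d b ->
    ~~ ((c' == d) && (d == special a')) -> normal (u0 ++ (d, b) :: (a', c') :: w0).
  move=> nw' kd db nf; apply: (normal_glue nu) kd.
  by rewrite [normal _]/= db nf; exact: nw'.
(* As the product is zero, main term and correction agree. The first letter of [u] may be varied
   among [(d, b)] with [d] akin to [c1]. *)
have top a' c' d : normal ((a', c') :: w0) -> kin c1 d -> adj d b ->
    ~~ ((c' == d) && (d == special a')) ->
    coef x ((a', c') :: w0) * coef y (u0 ++ [:: (d, b)]) =
    (if (c' == d) && (c' != special a') then
        coef x ((a', special a') :: w0) * coef y (u0 ++ [:: (special a', b)]) else 0).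
  move=> nw' kd db nf; have := top_coef lew' leu' erefl erefl (nz _ _ _ nw' kd db nf).
  by rewrite xy0 /coef (act0 word_repP) => /esym/eqP; rewrite subr_eq0 => /eqP.
have kin1 : kin c1 c1 by apply: (kin_adj Ev cb); rewrite adjC.
have nzxy : coef x ((a, c) :: w0) * coef y (u0 ++ [:: (c1, b)]) != 0.
  by rewrite mulf_eq0 negb_or cw cu.
(* For [c <> c1] there is no correction, so the nonzero main term would vanish. *)
have [ec|nec] := eqVneq c c1; last first.
  by move: nzxy; rewrite top ?(negbTE nec) ?eqxx.
subst c1.
have kin_ac d : adj a d -> kin c d by apply: (kin_adj Ev); rewrite adjC.
have ab : kin a b := kin_adj Ev ac cb.
have asp : adj a (special a) := adj_sp ab.
have spb : adj (special a) b by rewrite (kin_sp ab) adjC (@adj_sp _ a) // kinC.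
(* For [c <> special a], the junction [(a, c) (special a, b)] has no correction. This kills the
   coefficient of [y] at [(special a, b)], and with it the correction to the main term. *)
have [eca|nca] := eqVneq c (special a); last first.
  have nf : ~~ ((c == c) && (c == special a)) by rewrite (negbTE nca) andbF.
  move: nzxy; rewrite (top _ _ _ nw kin1 cb nf) eqxx nca /=.
  have := top a c (special a) nw (kin_ac _ asp) spb.
  rewrite eqxx andbT nca (negbTE nca) => /(_ isT) /eqP.
  by rewrite mulf_eq0 (negbTE cw) => /eqP ->; rewrite mulr0 eqxx.
(* For [c = special a] the leading words meet in a forbidden factor. Their product of coefficients
   is then the correction at [(a, special' a) (special' a, b)], whose main term vanishes because of
   the junction [(a, c) (special' a, b)]. *)
have asp' : adj a (special' a) := adj_sp' ab.
have sp'b : adj (special' a) b.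
  have -> : special' a = special' b by case: (a) (b) ab => [?|?] [?|?].
  by rewrite adjC (@adj_sp' _ a) // kinC.
have nw' : normal ((a, special' a) :: w0) by move: nw => /= /and3P[_ -> ->]; rewrite asp'.
have := top a (special' a) (special' a) nw' (kin_ac _ asp') sp'b.
rewrite eqxx sp_neq -eca => /(_ isT).
have := top a c (special' a) nw (kin_ac _ asp') sp'b.
rewrite eca eq_sym (negbTE (sp_neq a)) -eca => /(_ isT) /eqP.
rewrite mulf_eq0 (negbTE cw) => /eqP ->; rewrite mulr0 => /esym/eqP.
by rewrite (negbTE nzxy).
Qed.

Lemma coef_mon w u : normal w -> coef (mon w) u = (w == u)%:R.
Proof. by move=> nw; rewrite /coef act_mon_glue ?cats0. Qed.

Lemma runit_neq0 : runit <> 0.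
Proof.
move=> u0; have := @coef_mon [::] [::] isT.
by rewrite /= u0 /coef (act0 word_repP) => /eqP; rewrite eq_sym oner_eq0.
Qed.

(** Words in the [e_i] without ghosts contain no forbidden factor, so the two products of [e_1] and
    [e_2] for [e = e0] are distinct basis elements. *)
Lemma rose_noncomm : exists x y : A, (x * y)%g <> (y * x)%g.
Proof.
have wt_e i : (i < 2)%N -> (i < wt e0)%N by move=> i2; apply: leq_trans (wt_ge2 e0).
pose g i : U * U := (inl i, inr e0).
have nw i j : (i < 2)%N -> (j < 2)%N -> normal [:: g i; g j].
  by move=> i2 j2; rewrite /= !wt_e.
exists (mon [:: g 0%N]), (mon [:: g 1%N]); rewrite -!mon_cat /= => gg.
have := @coef_mon [:: g 0%N; g 1%N] [:: g 0%N; g 1%N] (nw 0%N 1%N isT isT).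
have := @coef_mon [:: g 1%N; g 0%N] [:: g 0%N; g 1%N] (nw 1%N 0%N isT isT).
by rewrite eqxx /= gg => -> /eqP; rewrite eq_sym oner_eq0.
Qed.
End NormalForms.

(** * Leavitt path algebras that are domains *)

Section LeavittPathDomain.
Variables (K : fieldType) (F : digraph).
Local Notation A := (LPA K F).
Local Notation gen t := (cls (@LPA_rel K F) t : A).
Hypothesis A_domain : is_domain A.

Let vert u : A := gen (p_vertex K u).
Let edg e : A := gen (p_edge K e).
Let gho e : A := gen (p_ghost K e).

Let mul0 (a b : A) : (a * b)%g = 0 -> a = 0 \/ b = 0.
Proof. exact: (proj2 A_domain). Qed.

Let relM s t u : LPA_rel (TMul s t) u -> (gen s * gen t)%g = gen u.
Proof. by move=> h; rewrite -clsM; apply/clsP/cong_rel. Qed.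

Let ghost_edge e f : (gho e * edg f)%g = if e == f then vert (rng e) else 0.
Proof. by rewrite (relM (LPA_ghost_edge K e f)); case: eqP. Qed.

Let edge_rng e : (edg e * vert (rng e))%g = edg e.
Proof. exact/relM/LPA_edge_rng. Qed.

Let src_edge e : (vert (src e) * edg e)%g = edg e.
Proof. exact/relM/LPA_src_edge. Qed.

Let rng_ghost e : (vert (rng e) * gho e)%g = gho e.
Proof. exact/relM/LPA_rng_ghost. Qed.

(** Distinct vertices are orthogonal idempotents and [e^* f = 0] for distinct edges. In a domain
    this leaves a unit and at most one edge, inverse to its ghost. *)
Lemma LPA_domain_comm (x y : A) : (x * y)%g = (y * x)%g.
Proof.
have eq0 e : edg e = 0 -> gho e = 0.
  move=> e0; have := ghost_edge e e; rewrite e0 numul0r eqxx => v0.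
  by rewrite -rng_ghost -v0 numul0l.
have gq0 e : gho e = 0 -> edg e = 0.
  move=> e0; have := ghost_edge e e; rewrite e0 numul0l eqxx => v0.
  by rewrite -edge_rng -v0 numul0r.
have [u u0] : exists u, vert u <> 0.
  apply: contrapT => /forallNP v0; case: (proj1 A_domain) => a; apply.
  have {}v0 w : vert w = 0 by apply: contrapT.
  elim/presented_ind: a => [[w|e|e]||a b -> ->|k a ->|a b -> _].
  - exact: v0.
  - by rewrite -[LHS]/(edg e) -src_edge v0 numul0l.
  - by rewrite -[LHS]/(gho e) -rng_ghost v0 numul0l.
  - by [].
  - by rewrite addr0.
  - by rewrite scaler0.
  - by rewrite numul0l.
have u1 w : w != u -> vert w = 0.
  move=> wu; have := relM (LPA_vertex K w u); rewrite (negbTE wu) => /mul0[] //.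
have uu : (vert u * vert u)%g = vert u by rewrite (relM (LPA_vertex K u u)) eqxx.
have unitl a : (vert u * a)%g = a.
  have : (vert u * ((vert u * a)%g - a))%g = 0.
    by rewrite numulDr numulNr mulgA uu subrr.
  by case/mul0 => // /eqP; rewrite subr_eq0 => /eqP.
have unitr a : (a * vert u)%g = a.
  have : (((a * vert u)%g - a) * vert u)%g = 0.
    by rewrite numulDl numulNl -mulgA uu subrr.
  by case/mul0 => // /eqP; rewrite subr_eq0 => /eqP.
have rngu e : edg e <> 0 -> vert (rng e) = vert u.
  move=> e0; have [-> //|/u1 v0] := eqVneq (rng e) u; case: e0.
  by rewrite -edge_rng v0 numul0r.
have uniq_edge e f : edg e <> 0 -> edg f <> 0 -> e = f.
  move=> e0 f0; have := ghost_edge e f; case: eqP => // _ /mul0[/gq0|] //.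
(* The difference of [e e^*] and the unit annihilates [e] from the left. *)
have edge_ghost e : edg e <> 0 -> (edg e * gho e)%g = vert u.
  move=> e0; have : (((edg e * gho e)%g - vert u) * edg e)%g = 0.
    by rewrite numulDl numulNl -mulgA ghost_edge eqxx rngu // unitl unitr subrr.
  by case/mul0 => // /eqP; rewrite subr_eq0 => /eqP.
have vc w a : (vert w * a)%g = (a * vert w)%g.
  have [->|/u1 ->] := eqVneq w u; first by rewrite unitl unitr.
  by rewrite numul0l numul0r.
have eg e f : (edg e * gho f)%g = (gho f * edg e)%g.
  have [e0|e0] := pselect (edg e = 0); first by rewrite e0 numul0l numul0r.
  have [f0|f0] := pselect (edg f = 0); first by rewrite (eq0 _ f0) numul0l numul0r.
  by rewrite (uniq_edge e f) // edge_ghost // ghost_edge eqxx rngu.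
have ee e f : (edg e * edg f)%g = (edg f * edg e)%g.
  have [e0|e0] := pselect (edg e = 0); first by rewrite e0 numul0l numul0r.
  have [f0|f0] := pselect (edg f = 0); first by rewrite f0 numul0l numul0r.
  by rewrite (uniq_edge e f).
have gg e f : (gho e * gho f)%g = (gho f * gho e)%g.
  have [e0|e0] := pselect (edg e = 0); first by rewrite (eq0 _ e0) numul0l numul0r.
  have [f0|f0] := pselect (edg f = 0); first by rewrite (eq0 _ f0) numul0l numul0r.
  by rewrite (uniq_edge e f).
(* Applied twice, this reduces commutativity to pairs of generators. *)
have comm_ind (z : A) : (forall g, (gen (TGen g) * z)%g = (z * gen (TGen g))%g) ->
    forall a, (a * z)%g = (z * a)%g.
  move=> zg; elim/presented_ind => [g||a b az bz|k a az|a b az bz].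
  - exact: zg.
  - by rewrite numul0l numul0r.
  - by rewrite numulDl numulDr az bz.
  - by rewrite -nuscaleAl -nuscaleAr az.
  - by rewrite -mulgA bz mulgA az mulgA.
apply: (comm_ind) => g; apply/esym; apply: (comm_ind) => h.
case: g h => [w|e|e] [w'|f|f]; first [exact: vc | exact/esym/vc | exact: ee |
  exact: gg | exact: eg | exact/esym/eg].
Qed.

End LeavittPathDomain.

(** * Perturbations of finite rank *)

Section MonomialOperators.
Variable K : fieldType.
Local Notation V := {poly K}.

(** Polynomials serve as a space with a countable basis. Sorting exponents by residue modulo [n]
    identifies it with its [n]-th power: [slice] gives the components and [spread] the
    inclusions. *)
Definition slice (n i : nat) (p : V) : V := \poly_(k < size p) p`_(n * k + i).
Definition spread (n i : nat) (p : V) : V :=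
  \poly_(t < n * size p) (if (t %% n == i)%N then p`_(t %/ n)%N else 0).

Lemma coef_slice n i p k : (0 < n)%N -> (slice n i p)`_k = p`_(n * k + i).
Proof.
move=> n0; rewrite coef_poly; case: ltnP => // le; rewrite nth_default //.
by apply: leq_trans le _; nia.
Qed.

Lemma coef_spread n i p t : (0 < n)%N ->
  (spread n i p)`_t = if (t %% n == i)%N then p`_(t %/ n)%N else 0.
Proof.
move=> n0; rewrite coef_poly; case: ltnP => // le; rewrite nth_default ?if_same //.
by rewrite leq_divRL // mulnC.
Qed.

Lemma slice_spread n i j p : (i < n)%N -> (j < n)%N ->
  slice n i (spread n j p) = if i == j then p else 0.
Proof.
move=> hi hj; have n0 : (0 < n)%N by apply: leq_ltn_trans hi.
apply/polyP => k; rewrite coef_slice // coef_spread // mulnC modnMDl modn_small //.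
by rewrite divnMDl // divn_small // addn0; case: eqP; rewrite ?coef0.
Qed.

Lemma sum_spread_slice n p : (0 < n)%N -> \sum_(i < n) spread n i (slice n i p) = p.
Proof.
move=> n0; apply/polyP => t; rewrite coef_sum.
rewrite (bigD1 (Ordinal (ltn_pmod t n0))) //= coef_spread // eqxx coef_slice //.
rewrite mulnC -divn_eq big1 ?addr0 // => i ne; rewrite coef_spread //.
by case: eqP => // e; case/eqP: ne; apply/val_inj.
Qed.

Variables (U : eqType) (nb : U -> seq U).

(* For each [a], the space [V] is split into parts labelled by the neighbours of
   [a]; [mono a c] maps the part labelled [a] in the splitting of [c] onto the
   part labelled [c] in the splitting of [a], and kills the other parts. *)
Definition mono (a c : U) (p : V) : V :=
  if (c \in nb a) && (a \in nb c) then
    spread (size (nb a)) (index c (nb a)) (slice (size (nb c)) (index a (nb c)) p)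
  else 0.

Lemma mem_size_gt0 (T : eqType) (x : T) s : x \in s -> (0 < size s)%N.
Proof. by case: s. Qed.

Lemma mono_is_linear a c : linear (mono a c).
Proof.
move=> k p q; rewrite /mono; case: ifP => [/andP[ca ac]|_]; last by rewrite scaler0 addr0.
apply/polyP => t; rewrite coefD coefZ !coef_spread ?(mem_size_gt0 ca) //.
case: ifP => _; last by rewrite mulr0 addr0.
by rewrite !coef_slice ?(mem_size_gt0 ac) // coefD coefZ.
Qed.
HB.instance Definition _ a c :=
  GRing.isLinear.Build K V V *:%R (mono a c) (mono_is_linear a c).

Hypotheses (nb_sym : forall a c, (c \in nb a) = (a \in nb c)) (nb_uniq : forall a, uniq (nb a)).

(** In each summand the inner slice and spread both refer to the splitting of [c] and compose to
    zero unless [a = b]. Then the sum runs over the projections onto all parts of the splitting of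
    [a]. *)
Lemma mono_rel a b p : nb a != [::] ->
  \sum_(c <- nb a) mono a c (mono c b p) = if a == b then p else 0.
Proof.
move=> nba; have na0 : (0 < size (nb a))%N by case: (nb a) nba.
rewrite (eq_big_seq (fun c => if a == b then
   spread (size (nb a)) (index c (nb a)) (slice (size (nb a)) (index c (nb a)) p) else 0)).
  case: eqP => _; last by rewrite big1.
  rewrite (big_nth a) big_mkord -[RHS](sum_spread_slice p na0).
  by apply: eq_bigr => i _; rewrite index_uniq.
move=> c ca; have ac : a \in nb c by rewrite -nb_sym.
rewrite /mono ca ac (nb_sym b c) andbb; case: (boolP (b \in nb c)) => bc; last first.
  case: eqP => [ab|_]; first by rewrite -ab ac in bc.
  apply/polyP => t; rewrite coef_spread // coef0; case: ifP => // _.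
  by rewrite coef_slice ?(mem_size_gt0 ac) // coef0.
rewrite slice_spread ?index_mem //; case: (altP (a =P b)) => [<-|ab].
  by rewrite eqxx.
case: eqP => [/(congr1 (nth a (nb c)))|_].
  by rewrite !nth_index // => /eqP; rewrite (negbTE ab).
by apply/polyP => t; rewrite coef_spread // !coef0 if_same.
Qed.

End MonomialOperators.

Section Near.
Variable K : fieldType.
Local Notation V := {poly K}.

(* As operators on a space with a countable basis, [h] and [h'] differ by an
   operator of finite rank. *)
Definition near (h h' : V -> V) : Prop := exists d, forall u, (size (h u - h' u)%R <= d)%N.

Lemma linear_bounded (L : {linear V -> V}) d :
  exists d', forall p : V, (size p <= d)%N -> (size (L p) <= d')%N.
Proof.
exists (\max_(i < d) size (L 'X^i)) => p pd.
rewrite -[p](coefK p) poly_def linear_sum; apply: (leq_trans (size_sum _ _ _)).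
apply/bigmax_leqP => i _; rewrite linearZ; apply: (leq_trans (size_scale_leq _ _)).
exact: (@leq_bigmax _ (fun i : 'I_d => size (L 'X^i)) (widen_ord pd i)).
Qed.

(** Operators of finite rank form a two-sided ideal. *)
Lemma near_ev (X : Type) (rho rho' : X -> {linear V -> V}) :
  (forall x, near (rho x) (rho' x)) -> forall t, near (ev rho t) (ev rho' t).
Proof.
move=> rr; elim => [x||s [d IHs]|s [d IHs] t [d' IHt]|k s [d IHs]|s [d IHs] t [d' IHt]] /=.
- exact: rr.
- by exists 0%N => u; rewrite subrr size_poly0.
- by exists d => u; rewrite -opprD size_polyN.
- exists (maxn d d') => u; rewrite opprD addrACA.
  by apply: (leq_trans (size_polyD _ _)); rewrite geq_max !leq_max IHs IHt ?orbT.
- by exists d => u; rewrite -scalerBr; apply: (leq_trans (size_scale_leq _ _)).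
- have [d'' hd''] := linear_bounded (ev rho s) d'.
  exists (maxn d d'') => u.
  rewrite -[X in X - _](subrK (ev rho s (ev rho' t u))) -addrA -linearB.
  by apply: (leq_trans (size_polyD _ _)); rewrite geq_max !leq_max IHs hd'' ?orbT.
Qed.

(** Evaluation at one vector applies generators to finitely many intermediate vectors, which [Z]
    collects. *)
Lemma ev_agree (X : Type) (sigma : X -> {linear V -> V}) t u : exists Z : seq V,
  forall rho : X -> {linear V -> V},
    (forall x z, z \in Z -> rho x z = sigma x z) -> ev rho t u = ev sigma t u.
Proof.
elim: t u => [x||s IHs|s IHs t IHt|k s IHs|s IHs t IHt] u.
- by exists [:: u] => rho /= -> //; rewrite inE.
- by exists [::].
- by have [Z hZ] := IHs u; exists Z => rho /= /hZ ->.
- have [Z hZ] := IHs u; have [Z' hZ'] := IHt u; exists (Z ++ Z') => rho h /=.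
  by rewrite hZ ?hZ' // => x z zZ; apply: h; rewrite mem_cat zZ ?orbT.
- by have [Z hZ] := IHs u; exists Z => rho /= /hZ ->.
- have [Z hZ] := IHt u; have [Z' hZ'] := IHs (ev sigma t u); exists (Z ++ Z') => rho h /=.
  by rewrite hZ ?hZ' // => x z zZ; apply: h; rewrite mem_cat zZ ?orbT.
Qed.

End Near.

Lemma linear_comb (K : fieldType) (V W : lmodType K) (h : {linear V -> W}) k
    (c : 'I_k -> K) (F : 'I_k -> V) :
  h (\sum_i c i *: F i) = \sum_i c i *: h (F i).
Proof. by rewrite linear_sum; apply: eq_bigr => i _; rewrite linearZ. Qed.

(** * Tuples of polynomials and matrices of operators *)

Section FiniteRank.
Variable K : fieldType.
Local Notation V := {poly K}.
Local Notation Vn m := ('I_m -> V).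

Definition bounded m d (u : Vn m) := forall i, (size (u i) <= d)%N.

Section Truncation.
Variables (m d : nat).

(** With [embed], this identifies the tuples of polynomials of size at most [d] with row vectors, so
    that matrix algebra applies. *)
Definition trunc (u : Vn m) : 'rV[K]_(m * d) := mxvec (\matrix_(i, k) (u i)`_k).
Definition embed (A : 'rV[K]_(m * d)) : Vn m := fun i => rVpoly (row i (vec_mx A)).

Lemma trunc_is_linear : linear trunc.
Proof.
move=> k u u'; rewrite /trunc -linearP; congr mxvec; apply/matrixP => i j.
by rewrite !mxE [(_ + _) i]/= coefD coefZ.
Qed.
HB.instance Definition _ :=
  GRing.isLinear.Build K (Vn m) 'rV[K]_(m * d) *:%R trunc trunc_is_linear.

Lemma embed_is_linear : linear embed.
Proof. by move=> k A B; apply/funext => i; rewrite /embed !linearP. Qed.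
HB.instance Definition _ :=
  GRing.isLinear.Build K 'rV[K]_(m * d) (Vn m) *:%R embed embed_is_linear.

Lemma embedK A : trunc (embed A) = A.
Proof.
rewrite /trunc -[RHS]vec_mxK; congr mxvec; apply/matrixP => i k.
by rewrite mxE coef_rVpoly_ord mxE.
Qed.

Lemma truncK u : bounded d u -> embed (trunc u) = u.
Proof.
move=> ud; apply/funext => i; apply/polyP => k; rewrite /embed /trunc mxvecK coef_rVpoly.
case: insubP => [j _ <-|]; first by rewrite !mxE.
by rewrite -leqNgt => dk; rewrite nth_default // (leq_trans _ dk).
Qed.

Lemma bounded_embed A : bounded d (embed A).
Proof. by move=> i; apply: size_poly. Qed.

End Truncation.

Lemma boundedD m d (u u' : Vn m) : bounded d u -> bounded d u' -> bounded d (u + u').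
Proof.
move=> ud ud' i; apply: (leq_trans (size_polyD _ _)).
by rewrite geq_max ud ud'.
Qed.

Lemma boundedB m d (u u' : Vn m) : bounded d u -> bounded d u' -> bounded d (u - u').
Proof. by move=> ud ud'; apply: boundedD => // i; rewrite size_polyN. Qed.

Lemma bounded_leq m d d' (u : Vn m) : (d <= d')%N -> bounded d u -> bounded d' u.
Proof. by move=> dd ud i; apply: leq_trans dd. Qed.

(* A finite rank perturbation of the identity has Fredholm index zero. *)
Lemma finite_rank_inverse m d (T G : {linear Vn m -> Vn m}) :
  (forall u, bounded d (T u - u)) -> (forall u, bounded d (G u - u)) ->
  (forall u, G (T u) = u) -> forall u, T (G u) = u.
Proof.
move=> Td Gd GT.
have stab (L : {linear Vn m -> Vn m}) (A : 'rV_(m * d)) : (forall u, bounded d (L u - u)) ->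
    embed (trunc d (L (embed A))) = L (embed A).
  move=> Ld; apply: truncK; rewrite -[L _](subrK (embed A)).
  by apply: boundedD; [exact: Ld|exact: bounded_embed].
pose mx (L : {linear Vn m -> Vn m}) := lin1_mx (trunc d \o L \o @embed m d).
have mxE' L (A : 'rV_(m * d)) : A *m mx L = trunc d (L (embed A)) by rewrite mul_rV_lin1.
(* Matrices act on rows from the right, so this is [G] after [T]. Being square, they also
   commute. *)
have mxTG : mx T *m mx G = 1%:M.
  apply/row_matrixP => i; rewrite rowE [RHS]rowE mulmx1 mulmxA !mxE'.
  by rewrite stab // GT embedK.
have fixed u : bounded d u -> T (G u) = u.
  move=> ud; rewrite -(truncK ud) -[in LHS](stab G) // -[LHS](stab T) //.
  by rewrite -!mxE' -mulmxA (mulmx1C mxTG) mulmx1.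
(* The defect [w] is bounded, so [T G] fixes it. But [T G] is idempotent and maps [u] to [u + w], so
   it kills [w]. *)
move=> u; set w := T (G u) - u.
have wd : bounded d w.
  by rewrite /w -[T (G u)](subrK (G u)) -addrA; apply: boundedD; [exact: Td | exact: Gd].
have TGu : T (G u) = u + w by rewrite /w addrC subrK.
have : T (G u) + T (G w) = T (G u) + 0.
  by rewrite addr0 -linearD -linearD -TGu GT.
by move=> /addrI; rewrite fixed // TGu => ->; rewrite addr0.
Qed.

(** On a space of bounded tuples containing all [W i] and [h (W i)], injectivity lets [h] restricted
    to the span of the [W i] be completed to an invertible matrix. Beyond the truncation [g] is the
    identity. *)
Lemma finite_rank_interpolation m (h : {linear Vn m -> Vn m}) k (W : 'I_k -> Vn m) :
  injective h -> exists d (g g' : {linear Vn m -> Vn m}),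
  [/\ forall u, g (g' u) = u, forall u, g' (g u) = u,
      forall u, bounded d (g u - u), forall u, bounded d (g' u - u)
    & forall i, g (W i) = h (W i)].
Proof.
move=> h_inj.
have [d Wd] : exists d, forall i, bounded d (W i) /\ bounded d (h (W i)).
  exists (\max_(i < k) maxn (\max_(j < m) size (W i j)) (\max_(j < m) size (h (W i) j))).
  move=> i; split=> j; apply: leq_trans (leq_bigmax i); rewrite leq_max.
    by rewrite (@leq_bigmax _ (fun j => size (W i j))).
  by rewrite (@leq_bigmax _ (fun j => size (h (W i) j))) orbT.
pose Wm : 'M[K]_(k, m * d) := \matrix_i trunc d (W i).
pose f : 'M[K]_(m * d) := lin1_mx (trunc d \o h \o @embed m d).
have Wf c : c *m Wm *m f = trunc d (h (\sum_i c 0 i *: W i)).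
  rewrite mul_rV_lin1 /= mulmx_sum_row linear_sum; congr (trunc _ (h _)).
  by apply: eq_bigr => i _; rewrite linearZ rowK /= truncK //; case: (Wd i).
have bsum (F : 'I_k -> Vn m) (c : 'rV[K]_k) : (forall i, bounded d (F i)) ->
    bounded d (\sum_i c 0 i *: F i).
  move=> Fd; elim/big_ind: _ => [j||i _]; first by rewrite size_poly0.
  - by move=> *; apply: boundedD.
  - by move=> j; apply: leq_trans (size_scale_leq _ _) (Fd i j).
have rk : \rank (Wm *m f) = \rank Wm.
  apply/mxrank_injP/rowV0P => u; rewrite sub_capmx => /andP[/submxP[c ->] /sub_kermxP].
  rewrite Wf => /(congr1 (@embed m d)); rewrite truncK; last first.
    rewrite (linear_comb h).
    by apply: bsum => i; case: (Wd i).
  rewrite linear0 => h0; have W0 := h_inj _ _ (etrans h0 (esym (linear0 h))).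
  rewrite mulmx_sum_row; transitivity (\sum_i c 0 i *: trunc d (W i)).
    by apply: eq_bigr => i _; rewrite rowK.
  rewrite -(linear_comb (@trunc m d) (c 0) W).
  exact: etrans (congr1 (@trunc m d) W0) (linear0 _).
have [M Mu WM] := complete_unitmx rk.
pose ext (N : 'M[K]_(m * d)) : {linear Vn m -> Vn m} :=
  (idfun \- (@embed m d \o @trunc m d) \+ (@embed m d \o (mulmxr N \o @trunc m d))).
have extE N u : ext N u = u - embed (trunc d u) + embed (trunc d u *m N) by [].
have ext_bounded N u : bounded d (ext N u - u).
  rewrite extE addrC !addrA addNr add0r addrC.
  by apply: boundedB; apply: bounded_embed.
have trunc_ext N u : trunc d (ext N u) = trunc d u *m N.
  by rewrite extE linearD linearB /= !embedK subrr add0r.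
have extM N P u : ext N (ext P u) = ext (P *m N) u.
  by rewrite [LHS]extE trunc_ext [ext P u]extE addrK -mulmxA extE.
have ext1 u : ext 1%:M u = u by rewrite extE mulmx1 subrK.
exists d, (ext M), (ext (invmx M)); split => [u|u|u|u|i].
- by rewrite extM mulVmx.
- by rewrite extM mulmxV.
- exact: ext_bounded.
- exact: ext_bounded.
have [Wid hWid] := Wd i; rewrite extE truncK // subrr add0r.
have := congr1 (row i) WM; rewrite !row_mul !rowK => <-.
by rewrite mul_rV_lin1 /= !truncK.
Qed.

Section OperatorMatrix.
Variables n m : nat.

Definition mxop (a : 'I_n -> 'I_m -> {linear V -> V}) (u : Vn m) : Vn n :=
  fun i => \sum_j a i j (u j).

Lemma mxop_is_linear a : linear (mxop a).
Proof.
move=> k u u'; apply/funext => i.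
rewrite -[RHS]/(k *: mxop a u i + mxop a u' i) /mxop scaler_sumr -big_split.
by apply: eq_bigr => j _; rewrite [(_ + _) j]/= linearP.
Qed.
HB.instance Definition _ a :=
  GRing.isLinear.Build K (Vn m) (Vn n) *:%R (mxop a) (mxop_is_linear a).

Lemma mxop_bounded a d : exists d', forall u, bounded d u -> bounded d' (mxop a u).
Proof.
have [D hD] : exists D : 'I_n -> 'I_m -> nat, forall i j (p : V),
    (size p <= d)%N -> (size (a i j p) <= D i j)%N.
  have /choice[D hD] : forall ij : 'I_n * 'I_m, exists d', forall p : V,
      (size p <= d)%N -> (size (a ij.1 ij.2 p) <= d')%N.
    by move=> ij; apply: linear_bounded.
  by exists (fun i j => D (i, j)) => i j; apply: (hD (i, j)).
exists (\max_i \max_j D i j) => u ud i; apply: (leq_trans (size_sum _ _ _)).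
apply: leq_trans (leq_bigmax i); apply/bigmax_leqP => j _.
by apply: leq_trans (leq_bigmax j); apply: hD.
Qed.

Lemma near_mxop (a a' : 'I_n -> 'I_m -> {linear V -> V}) : (forall i j, near (a i j) (a' i j)) ->
  exists d, forall u, bounded d (mxop a u - mxop a' u).
Proof.
move=> aa.
have /choice[D hD] : forall ij : 'I_n * 'I_m, exists d, forall u,
    (size (a ij.1 ij.2 u - a' ij.1 ij.2 u)%R <= d)%N by move=> ij; apply: aa.
exists (\max_i \max_j D (i, j)) => u i.
rewrite -[(_ - _) i]/(mxop a u i - mxop a' u i) /mxop -sumrB.
apply: (leq_trans (size_sum _ _ _)).
apply: leq_trans (leq_bigmax i); apply/bigmax_leqP => j _.
by apply: leq_trans (leq_bigmax j); apply: (hD (i, j)).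
Qed.

End OperatorMatrix.

Definition entry m (i : 'I_m) (u : Vn m) : V := u i.

Lemma entry_is_linear m (i : 'I_m) : linear (entry i).
Proof. by []. Qed.
HB.instance Definition _ m (i : 'I_m) :=
  GRing.isLinear.Build K (Vn m) V *:%R (entry i) (entry_is_linear i).

Definition single m (j : 'I_m) (v : V) : Vn m := fun k => if k == j then v else 0.

Lemma single_is_linear m (j : 'I_m) : linear (single j).
Proof.
move=> k u u'; apply/funext => i.
rewrite -[RHS]/(k *: single j u i + single j u' i) /single.
by case: eqP => // _; rewrite scaler0 addr0.
Qed.
HB.instance Definition _ m (j : 'I_m) :=
  GRing.isLinear.Build K V (Vn m) *:%R (single j) (single_is_linear j).

Lemma mxop_single n m (a : 'I_n -> 'I_m -> {linear V -> V}) j v i :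
  mxop a (single j v) i = a i j v.
Proof.
rewrite /mxop (bigD1 j) //= /single eqxx big1 ?addr0 // => k /negbTE ->.
by rewrite linear0.
Qed.

Lemma sum_single m (u : Vn m) : \sum_j single j (u j) = u.
Proof.
apply/funext => i; have -> : (\sum_j single j (u j)) i = \sum_j single j (u j) i.
  by elim/big_rec2: _ => // j x y _ <-.
by rewrite (bigD1 i) //= /single eqxx big1 ?addr0 // => j; rewrite eq_sym => /negbTE ->.
Qed.

Definition mxop_inv n m (a : 'I_n -> 'I_m -> {linear V -> V})
    (b : 'I_m -> 'I_n -> {linear V -> V}) :=
  forall i k u, \sum_j a i j (b j k u) = if i == k then u else 0.

Lemma mxop_invP n m a b : @mxop_inv n m a b <-> forall u, mxop a (mxop b u) = u.
Proof.
have ab_single k v i : mxop a (mxop b (single k v)) i = \sum_j a i j (b j k v).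
  by apply: eq_bigr => j _; congr (a i j _); exact: mxop_single.
split=> [ab u|ab i k u]; last by rewrite -ab_single ab.
rewrite -[in LHS](sum_single u) 2!linear_sum -[RHS]sum_single.
by apply: eq_bigr => k _; apply/funext => i; rewrite [LHS]ab_single ab.
Qed.

(** Both [b0 a] and [b a0] are finite rank perturbations of the identity, and [(b a0) (b0 a) = 1].
    Hence [(b0 a) (b a0) = 1], and conjugation by [a0] gives [a b = 1]. *)
Lemma near_inverse n m (a a0 : 'I_n -> 'I_m -> {linear V -> V})
    (b b0 : 'I_m -> 'I_n -> {linear V -> V}) :
  mxop_inv b a -> mxop_inv a0 b0 -> mxop_inv b0 a0 ->
  (forall i j, near (a i j) (a0 i j)) -> (forall j i, near (b j i) (b0 j i)) ->
  mxop_inv a b.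
Proof.
move=> /mxop_invP ba /mxop_invP ab0 /mxop_invP ba0 /near_mxop[da aa] /near_mxop[db bb].
have [d1 hd1] := mxop_bounded b0 da.
pose T : {linear Vn m -> Vn m} := mxop b0 \o mxop a.
pose G : {linear Vn m -> Vn m} := mxop b \o mxop a0.
have TG : forall u, T (G u) = u.
  apply: (@finite_rank_inverse m (maxn d1 db)) => u.
  - rewrite -[T u]/(mxop b0 (mxop a u)) -{2}[u]ba0 -linearB.
    exact/(bounded_leq (leq_maxl _ _))/hd1.
  - rewrite -[G u]/(mxop b (mxop a0 u)) -{2}[u]ba0.
    exact/(bounded_leq (leq_maxr _ _)).
  - by rewrite -[LHS]/(mxop b (mxop a0 (mxop b0 (mxop a u)))) ab0 ba.
apply/mxop_invP => u.
by rewrite -[LHS]ab0 -[in LHS](ab0 u) -[X in mxop a0 X]/(T (G (mxop b0 u))) TG ab0.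
Qed.

(* [x'] is [x] composed with a perturbation of the identity interpolating [y x1]. *)
Lemma near_interpolation n m (x x1 : 'I_n -> 'I_m -> {linear V -> V})
    (y y1 : 'I_m -> 'I_n -> {linear V -> V}) (Z : seq V) :
  mxop_inv x y -> mxop_inv y x -> mxop_inv x1 y1 -> mxop_inv y1 x1 ->
  exists (x' : 'I_n -> 'I_m -> {linear V -> V}) (y' : 'I_m -> 'I_n -> {linear V -> V}),
  [/\ mxop_inv x' y' /\ mxop_inv y' x',
      forall i j, near (x' i j) (x i j) /\ near (y' j i) (y j i)
    & forall i j z, z \in Z -> x' i j z = x1 i j z /\ y' j i z = y1 j i z].
Proof.
move=> /mxop_invP xy /mxop_invP yx /mxop_invP xy1 /mxop_invP yx1.
pose h : {linear Vn m -> Vn m} := mxop y \o mxop x1.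
have h_inj : injective h.
  move=> u u' /(congr1 (mxop x)); rewrite -![h _]/(mxop y (mxop x1 _)) !xy.
  by move/(congr1 (mxop y1)); rewrite !yx1.
pose I := ('I_m * 'I_(size Z) + 'I_n * 'I_(size Z))%type.
(* The first kind of points makes [x g] agree with [x1] on [Z], the second makes [g' y] agree with
   [y1]. *)
pose W (k : 'I_#|{: I}|) : Vn m :=
  match enum_val k with
  | inl (j, z) => single j (nth 0 Z z)
  | inr (i, z) => mxop y1 (single i (nth 0 Z z))
  end.
have [d [g [g' [gg' g'g gd g'd gW]]]] := finite_rank_interpolation W h_inj.
pose x' i j : {linear V -> V} := @entry n i \o (mxop x \o (g \o @single m j)).
pose y' j i : {linear V -> V} := @entry m j \o (g' \o (mxop y \o @single n i)).
have x'E u : mxop x' u = mxop x (g u).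
  rewrite -{2}[u]sum_single !linear_sum; apply/funext => i.
  rewrite (_ : (\sum_j _) i = \sum_j mxop x (g (single j (u j))) i) //.
  by elim/big_rec2: _ => // j p q _ <-.
have y'E u : mxop y' u = g' (mxop y u).
  rewrite -{2}[u]sum_single !linear_sum; apply/funext => j.
  rewrite (_ : (\sum_i _) j = \sum_i g' (mxop y (single i (u i))) j) //.
  by elim/big_rec2: _ => // i p q _ <-.
have [d' hd'] := mxop_bounded x d.
exists x', y'; split.
- by split; apply/mxop_invP => u; rewrite x'E y'E ?gg' ?xy // yx g'g.
- move=> i j; split.
    exists d' => u; rewrite -(mxop_single x j u i).
    have := hd' _ (gd (single j u)) i; rewrite linearB; exact.
  exists d => u; rewrite -(mxop_single y i u j).
  exact: g'd.
move=> i j z zZ.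
have zi : (index z Z < size Z)%N by rewrite index_mem.
have gz : g (single j z) = h (single j z).
  have := gW (enum_rank (inl (j, Ordinal zi) : I)).
  by rewrite /W enum_rankK /= nth_index.
have gy : g (mxop y1 (single i z)) = h (mxop y1 (single i z)).
  have := gW (enum_rank (inr (i, Ordinal zi) : I)).
  by rewrite /W enum_rankK /= nth_index.
split.
  rewrite -[LHS]/(mxop x (g (single j z)) i) gz -[h _]/(mxop y (mxop x1 _)) xy.
  exact: mxop_single.
rewrite -[LHS]/(g' (mxop y (single i z)) j) -(mxop_single y1 i z j).
by rewrite -[in LHS](xy1 (single i z)) -[mxop y _]/(h _) -gy g'g.
Qed.

End FiniteRank.

(** * Comparison with Leavitt algebras *)

Section LeavittModules.
Variables (K : fieldType) (n m : nat).
Local Notation V := {poly K}.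
Local Notation L := (leavitt K n m).
Variables (x : 'I_n -> 'I_m -> {linear V -> V}) (y : 'I_m -> 'I_n -> {linear V -> V}).

Definition leavitt_rep (g : leavitt_gen n m) : {linear V -> V} :=
  match g with
  | LOne => idfun
  | LX i j => x i j
  | LY j i => y j i
  end.

Hypotheses (xy : mxop_inv x y) (yx : mxop_inv y x).

Lemma leavitt_repP s t : @leavitt_rel K n m s t -> ev leavitt_rep s =1 ev leavitt_rep t.
Proof.
case=> {s t} [g|g|i k|j l] u //.
- by rewrite ev_sum -[LHS]/(\sum_j x i j (y j k u)) xy; case: eqP.
- by rewrite ev_sum -[LHS]/(\sum_i y j i (x i l u)) yx; case: eqP.
Qed.

End LeavittModules.

(** * Transport of actions along an isomorphism with a Leavitt algebra *)

Section Transport.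
Variables (K : fieldType) (n m : nat) (E : wgraph) (v : vertex E).
Hypothesis Ev : forall u : vertex E, u = v.
Local Notation V := {poly K}.
Local Notation L := (leavitt K n m).
Local Notation A := (wLPA K E).
Local Notation gen t := (cls (@leavitt_rel K n m) t : L).
Local Notation runit := (runit K v).
Variables (f : {linear A -> L}) (f' : L -> A).
Hypotheses (fK : cancel f f') (f'K : cancel f' f)
  (fM : forall a b : A, f (a * b)%g = (f a * f b)%g).

Lemma leavitt_mul1 (a : L) : (a * gen (l_one K n m))%g = a.
Proof.
elim/presented_ind: a => [g||a b IHa IHb|k a IHa|a b IHa IHb].
- by rewrite -clsM; apply/clsP/cong_rel; constructor.
- exact: numul0l.
- by rewrite numulDl IHa IHb.
- by rewrite -nuscaleAl IHa.
- by rewrite -mulgA IHb.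
Qed.

(** An isomorphism is only required to respect products; a left unit and a right unit coincide. *)
Lemma iso_unit : f runit = gen (l_one K n m).
Proof.
by rewrite -[LHS]leavitt_mul1 -[X in (_ * X)%g]f'K -fM (runit_mul Ev) f'K.
Qed.

Lemma inv_unit : f' (gen (l_one K n m)) = runit.
Proof. by rewrite -iso_unit fK. Qed.

Lemma invD a b : f' (a + b) = f' a + f' b.
Proof. by apply: (can_inj fK); rewrite linearD !f'K. Qed.

Lemma inv0 : f' 0 = 0.
Proof. by apply: (can_inj fK); rewrite linear0 f'K. Qed.

Lemma invZ k a : f' (k *: a) = k *: f' a.
Proof. by apply: (can_inj fK); rewrite linearZ !f'K. Qed.

Lemma invM a b : f' (a * b)%g = (f' a * f' b)%g.
Proof. by apply: (can_inj fK); rewrite fM !f'K. Qed.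

Lemma inv_sum I (r : seq I) F : f' (\sum_(i <- r) F i) = \sum_(i <- r) f' (F i).
Proof. by apply: big_morph; [exact: invD | exact: inv0]. Qed.

Variable rho : wLPA_gen E -> {linear V -> V}.
Hypotheses (rhoP : forall s t, @wLPA_rel K E s t -> ev rho s =1 ev rho t)
  (rho1 : forall u, act rho (runit : A) u = u).

Definition trans_x (i : 'I_n) (j : 'I_m) : {linear V -> V} := act rho (f' (gen (l_x K i j))).
Definition trans_y (j : 'I_m) (i : 'I_n) : {linear V -> V} := act rho (f' (gen (l_y K j i))).

Lemma trans_xy : mxop_inv trans_x trans_y.
Proof.
move=> i k u; rewrite /trans_x /trans_y /=.
under eq_bigr do rewrite -(actM rhoP) -invM -clsM.
rewrite -(act_sum rhoP) -inv_sum -cls_sum.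
have /cong_rel/clsP -> := @leavitt_XY K n m i k.
by case: eqP => _; rewrite ?inv_unit ?rho1 // [cls _ _]cls0 inv0 (act0 rhoP).
Qed.

Lemma trans_yx : mxop_inv trans_y trans_x.
Proof.
move=> j l u; rewrite /trans_x /trans_y /=.
under eq_bigr do rewrite -(actM rhoP) -invM -clsM.
rewrite -(act_sum rhoP) -inv_sum -cls_sum.
have /cong_rel/clsP -> := @leavitt_YX K n m j l.
by case: eqP => _; rewrite ?inv_unit ?rho1 // [cls _ _]cls0 inv0 (act0 rhoP).
Qed.

Lemma act_trans (a : L) u : act (leavitt_rep trans_x trans_y) a u = act rho (f' a) u.
Proof.
have P := leavitt_repP trans_xy trans_yx.
elim/presented_ind: a u => [g||a b IHa IHb|k a IHa|a b IHa IHb] u.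
- rewrite (act_cls P); case: g => [|i j|j i] //=.
  by rewrite [f' _]inv_unit rho1.
- by rewrite (act0 P) inv0 (act0 rhoP).
- by rewrite (actD P) invD (actD rhoP) IHa IHb.
- by rewrite (actZ P) invZ (actZ rhoP) IHa.
- by rewrite (actM P) invM (actM rhoP) IHa IHb.
Qed.

End Transport.

(** * Monomial actions of the rose algebra *)

Section MonomialRose.
Variables (K : fieldType) (E : wgraph) (v : vertex E).
Hypothesis Ev : forall u : vertex E, u = v.
Local Notation V := {poly K}.
Local Notation A := (wLPA K E).
Local Notation U := (nat + edge E)%type.
Variable S : U -> U -> bool.
Hypotheses (S_sym : forall a c, S a c = S c a) (S_adj : forall a c, S a c -> adj a c)
  (S_ex : forall a, kin v a a -> exists c, S a c).

(** [S] is a bipartite graph on rows and columns in which every row in range and every column has a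
    neighbour; letters outside [S] act as zero. *)
Definition nbh (a : U) : seq U := [seq c <- opposite v a | S a c].
Definition mono_rep : wLPA_gen E -> {linear V -> V} := rose_rep idfun (@mono K _ nbh).

Lemma mem_nbh a c : (c \in nbh a) = S a c.
Proof.
rewrite mem_filter; case: (boolP (S a c)) => //= /S_adj; exact: adj_opposite.
Qed.

Lemma nbh_sym a c : (c \in nbh a) = (a \in nbh c).
Proof. by rewrite !mem_nbh S_sym. Qed.

Lemma nbh_uniq a : uniq (nbh a).
Proof. by rewrite filter_uniq ?opposite_uniq. Qed.

Lemma mono_nadj a c (p : V) : ~~ adj a c -> mono nbh a c p = 0.
Proof.
by rewrite /mono mem_nbh; case: (boolP (S a c)) => //= /S_adj ->.
Qed.

Lemma mono_nbh_rel a b (p : V) : kin v a b ->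
  \sum_(c <- nbh a) mono nbh a c (mono nbh c b p) = if a == b then p else 0.
Proof.
move=> ab; apply: mono_rel; [exact: nbh_sym | exact: nbh_uniq |].
have [c] : exists c, S a c.
  by apply: S_ex; case: (a) (b) ab => [i|e] [j|f] //= /andP[->].
by rewrite -mem_nbh; case: nbh.
Qed.

Let PP (u : V) : idfun (idfun u) = idfun u. Proof. by []. Qed.
Let Pr a c (u : V) : adj a c -> idfun (mono nbh a c u) = mono nbh a c u. Proof. by []. Qed.
Let rP a c (u : V) : adj a c -> mono nbh a c (idfun u) = mono nbh a c u. Proof. by []. Qed.
Let r_rel a b (u : V) : kin v a b ->
  \sum_(c <- opposite v a | adj a c && adj c b) mono nbh a c (mono nbh c b u)
  = if a == b then idfun u else 0.
Proof.
move=> ab; rewrite -(mono_nbh_rel u ab) /= big_filter big_mkcond [RHS]big_mkcond.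
apply: eq_bigr => c _; case: (boolP (S a c)) => [ac|nac].
  by rewrite S_adj //=; case: ifPn => // /mono_nadj ->; rewrite linear0.
by rewrite /mono mem_nbh (negbTE nac) /= if_same.
Qed.

Lemma mono_repP s t : @wLPA_rel K E s t -> ev mono_rep s =1 ev mono_rep t.
Proof. exact: (rose_repP Ev PP Pr rP r_rel). Qed.

Lemma mono_rep_unit u : act mono_rep (runit K v : A) u = u.
Proof. exact: (act_runit Ev PP Pr rP r_rel). Qed.

Lemma mono_rep_letter a c u : act mono_rep (letter K a c : A) u = mono nbh a c u.
Proof.
rewrite (act_letter Ev PP Pr rP r_rel); case: (boolP (adj a c)) => // /mono_nadj -> //.
Qed.

End MonomialRose.

(** * Two actions that a Leavitt algebra cannot separate *)

Section NotLeavitt.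
Variables (K : fieldType) (E : wgraph) (v : vertex E).
Hypothesis Ev : forall u : vertex E, u = v.
Hypothesis wt_ge2 : forall e : edge E, (2 <= wt e)%N.
Variables (e0 em : edge E).
Hypotheses (wt_e0 : wt e0 = vwt v) (em_min : forall e : edge E, (wt em <= wt e)%N)
  (em_e0 : (wt em < wt e0)%N).

Local Notation V := {poly K}.
Local Notation A := (wLPA K E).
Local Notation U := (nat + edge E)%type.
Local Notation runit := (runit K v).
Local Notation letter a c := (letter K (a : U) (c : U) : A).
Local Notation r := (wt em).

Definition light : seq (edge E) := [seq e <- edges v | wt e == r].
Local Notation c := (size light).
Local Notation le j := (nth em light j).

Definition rel_of (P : nat -> edge E -> bool) (a b : U) : bool :=
  match a, b with
  | inl i, inr e | inr e, inl i => (i < wt e)%N && P i e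
  | _, _ => false
  end.

Lemma rel_of_sym P a b : rel_of P a b = rel_of P b a.
Proof. by case: a b => [i|e] [j|g]. Qed.

Lemma rel_of_adj P a b : rel_of P a b -> adj a b.
Proof. by case: a b => [i|e] [j|g] //= /andP[]. Qed.

Lemma rel_of_ex (P : nat -> edge E -> bool) :
  (forall i, (i < vwt v)%N -> exists2 e, (i < wt e)%N & P i e) ->
  (forall e, exists2 i, (i < wt e)%N & P i e) ->
  forall a, kin v a a -> exists b, rel_of P a b.
Proof.
move=> Pi Pe [i|e] /=; first by case/andP=> /Pi[e ie Pie] _; exists (inr e); rewrite /= ie.
by move=> _; have [i ie Pie] := Pe e; exists (inl i); rewrite /= ie.
Qed.

(* The matrix of the lightest edges is invertible in the action defined by
   [block], while its row 0 vanishes in the one defined by [avoid]. *)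
Definition block (i : nat) (e : edge E) : bool := (i < r)%N == (wt e == r).
Definition avoid (i : nat) (e : edge E) : bool := ~~ ((i == 0)%N && (wt e == r)).

Lemma block_ex a : kin v a a -> exists b, rel_of block a b.
Proof.
move: a; apply: rel_of_ex => [i iv|e].
  have [ir|ri] := ltnP i r; first by exists em; rewrite // /block ir eqxx.
  exists e0; first by rewrite wt_e0.
  by rewrite /block ltnNge ri (gtn_eqF em_e0).
have [er|ne] := eqVneq (wt e) r.
  by exists 0%N; rewrite /block er ?eqxx ?(ltn_trans _ (wt_ge2 em)).
exists r; last by rewrite /block ltnn (negbTE ne).
by rewrite ltn_neqAle eq_sym ne em_min.
Qed.

Lemma avoid_ex a : kin v a a -> exists b, rel_of avoid a b.
Proof.
move: a; apply: rel_of_ex => [i iv|e].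
  exists e0; first by rewrite wt_e0.
  by rewrite /avoid (gtn_eqF em_e0) andbF.
by exists 1%N; [exact: wt_ge2 | rewrite /avoid].
Qed.

Lemma mem_light e : (e \in light) = (wt e == r).
Proof. by rewrite mem_filter mem_edges ?andbT. Qed.

Lemma light_uniq : uniq light.
Proof. by rewrite filter_uniq ?edges_uniq. Qed.

Lemma sum_light (B : nmodType) (F : edge E -> B) :
  \sum_(e <- light) F e = \sum_(j < c) F (le j).
Proof. by rewrite (big_nth em) big_mkord. Qed.

(** Relation (iv) for two lightest edges: their letters vanish from row [r] on, whence [YX = 1] in
    every action. *)
Lemma light_rel (j k : 'I_c) :
  \sum_(i < r) (letter (inr (le j)) (inl (i : nat)) * letter (inl (i : nat)) (inr (le k)))%g
  = if j == k then runit else 0.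
Proof.
have wj : wt (le j) = r by apply/eqP; rewrite -mem_light mem_nth.
have := letter_rel K Ev (a := inr (le j)) (b := inr (le k)) isT.
rewrite big_map big_mkord -[inr _ == _]/(le j == le k) nth_uniq ?light_uniq // => <-.
have rv : (r <= vwt v)%N by rewrite -wt_e0 ltnW.
rewrite (big_ord_widen (vwt v)
  (fun i => (letter (inr (le j)) (inl i) * letter (inl i) (inr (le k)))%g)) //.
rewrite big_mkcond; apply: eq_bigr => i _; case: ifPn => // ir.
by rewrite letter_nadj ?numul0l //= wj.
Qed.

Lemma nbh_block i : (i < r)%N ->
  nbh v (rel_of block) (inl i) = [seq inr e | e <- light].
Proof.
move=> ir; rewrite /nbh /= filter_map; congr map; apply: eq_in_filter => e _ /=.
by rewrite /block (leq_trans ir (em_min e)) ir; case: (wt e == r).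
Qed.

Lemma rose_not_leavitt n m : ~ alg_isomorphic A (leavitt K n m).
Proof.
case=> f [[f' fK f'K] fM].
pose rho0 : wLPA_gen E -> {linear V -> V} := mono_rep K v (rel_of block).
pose rho1 : wLPA_gen E -> {linear V -> V} := mono_rep K v (rel_of avoid).
have P0 := mono_repP (K:=K) Ev (@rel_of_sym block) (@rel_of_adj block) block_ex.
have P1 := mono_repP (K:=K) Ev (@rel_of_sym avoid) (@rel_of_adj avoid) avoid_ex.
have u0 := mono_rep_unit (K:=K) Ev (@rel_of_sym block) (@rel_of_adj block) block_ex.
have u1 := mono_rep_unit (K:=K) Ev (@rel_of_sym avoid) (@rel_of_adj avoid) avoid_ex.
have l0 := mono_rep_letter (K:=K) Ev (@rel_of_sym block) (@rel_of_adj block) block_ex.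
have l1 := mono_rep_letter (K:=K) Ev (@rel_of_sym avoid) (@rel_of_adj avoid) avoid_ex.
have xy0 := trans_xy Ev fK f'K fM P0 u0; have yx0 := trans_yx Ev fK f'K fM P0 u0.
have xy1 := trans_xy Ev fK f'K fM P1 u1; have yx1 := trans_yx Ev fK f'K fM P1 u1.
have actE0 := act_trans Ev fK f'K fM P0 u0; have actE1 := act_trans Ev fK f'K fM P1 u1.
set x0 := trans_x _ _ in xy0 yx0 actE0; set y0 := trans_y _ _ in xy0 yx0 actE0.
set x1 := trans_x _ _ in xy1 yx1 actE1; set y1 := trans_y _ _ in xy1 yx1 actE1.
(* The entry of [XY] at row and column 0. *)
pose w : A := \sum_(e <- light) (letter (inl 0%N) (inr e) * letter (inr e) (inl 0%N))%g.
have [Z hZ] := ev_agree (leavitt_rep x1 y1) (rep (f w)) 1.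
(* A Leavitt action close to the [block] action which treats [f w] at the vector 1 as the [avoid]
   action does. *)
have [x [y [[xy yx] xy_near xyZ]]] := near_interpolation Z xy0 yx0 xy1 yx1.
have P := leavitt_repP xy yx.
pose theta (a : A) : {linear V -> V} := act (leavitt_rep x y) (f a).
have thetaM a b u : theta (a * b)%g u = theta a (theta b u).
  by rewrite /theta /= fM (actM P).
have theta_sum I (s : seq I) (F : I -> A) u :
    theta (\sum_(i <- s) F i) u = \sum_(i <- s) theta (F i) u.
  by rewrite /theta /= linear_sum (act_sum P).
have theta1 u : theta runit u = u.
  by rewrite /theta /= (iso_unit Ev f'K fM) (act_cls P).
have theta0 u : theta 0 u = 0 by rewrite /theta /= linear0 (act0 P).
have theta_near a : near (theta a) (act rho0 a).
  have [d hd] : near (theta a) (act (leavitt_rep x0 y0) (f a)).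
    apply: near_ev => -[|i j|j i] /=; first by exists 0%N => u; rewrite subrr size_poly0.
      exact: (xy_near i j).1.
    exact: (xy_near i j).2.
  by exists d => u; have := hd u; rewrite actE0 fK.
(* In the [avoid] action the letters in row 0 of the lightest edges are zero. *)
have theta_w : theta w 1 = 0.
  rewrite /theta /= /act hZ; last first.
    move=> [|i j|j i] z zZ //=; [exact: (xyZ i j z zZ).1 | exact: (xyZ i j z zZ).2].
  transitivity (act rho1 w 1); first by rewrite -[in RHS](fK w) -actE1.
  rewrite (act_sum P1) big1_seq // => e /andP[_ ee].
  have wr : wt e = r by apply/eqP; rewrite -mem_light.
  by rewrite (actM P1) l1 /mono (mem_nbh Ev (@rel_of_adj avoid)) /= /avoid wr !eqxx /= andbF.
pose xmat (a : A -> {linear V -> V}) (i : 'I_r) (j : 'I_c) :=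
  a (letter (inl (i : nat)) (inr (le j))).
pose ymat (a : A -> {linear V -> V}) (j : 'I_c) (i : 'I_r) :=
  a (letter (inr (le j)) (inl (i : nat))).
pose alpha (a : A) : {linear V -> V} := act rho0 a.
have alpha_inv : mxop_inv (xmat alpha) (ymat alpha).
  move=> i k u; have rv : (r < vwt v)%N by rewrite -wt_e0.
  have ik : kin v (inl (i : nat)) (inl (k : nat)).
    by rewrite /= !(ltn_trans _ rv).
  have := mono_nbh_rel Ev (@rel_of_sym block) (@rel_of_adj block) block_ex u ik.
  rewrite nbh_block // big_map sum_light -[inl _ == _]/((i : nat) == k) => <-.
  by apply: eq_bigr => j _; exact: etrans (l0 _ _ _) (congr1 _ (l0 _ _ _)).
have alpha_inv' : mxop_inv (ymat alpha) (xmat alpha).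
  move=> j k u; rewrite /xmat /ymat /alpha /=.
  under eq_bigr do rewrite -(actM P0).
  by rewrite -(act_sum P0) light_rel; case: eqP; rewrite ?u0 ?(act0 P0).
have theta_inv : mxop_inv (ymat theta) (xmat theta).
  move=> j k u; rewrite /xmat /ymat; under eq_bigr do rewrite -thetaM.
  by rewrite -theta_sum light_rel; case: eqP; rewrite ?theta1 ?theta0.
(* So [XY = 1] under [theta], whereas its entry [w] sends 1 to 0. *)
have := near_inverse theta_inv alpha_inv alpha_inv'
  (fun _ _ => theta_near _) (fun _ _ => theta_near _).
have r0 : (0 < r)%N by apply: ltn_trans (wt_ge2 em).
move=> /(_ (Ordinal r0) (Ordinal r0) 1); rewrite eqxx /xmat /ymat /=.
under eq_bigr do rewrite -thetaM.
rewrite -theta_sum -(sum_light (fun e => letter (inl 0%N) (inr e) * letter (inr e) (inl 0%N))%g).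
by rewrite theta_w => /esym/eqP; rewrite oner_eq0.
Qed.

End NotLeavitt.

Theorem corollary16 (K : fieldType) (E : wgraph)
    (E_rose : LV_rose E)
    (E_weights : exists e f : edge E, wt e <> wt f) :
  is_domain (wLPA K E) /\
  (forall F : digraph, ~ alg_isomorphic (wLPA K E) (LPA K F)) /\
  (forall n k : nat, (1 <= n)%N ->
     ~ alg_isomorphic (wLPA K E) (leavitt K n (n + k)%N)).
Proof.
have [v [Ev wt_ge2 [e0 [e1 [e01 wt_e0 wt_e1]]]]] := E_rose.
have domain : is_domain (wLPA K E).
  split; last exact: (rose_domain Ev wt_ge2 e01 wt_e0 wt_e1).
  by exists (runit K v); exact: (runit_neq0 Ev wt_ge2 wt_e0).
split=> //; split=> [F|n k _].
  case=> f [[f' fK f'K] fM].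
  have LPA_domain : is_domain (LPA K F).
    case: domain => -[a a0] dom; split.
      exists (f a) => fa0; apply: a0; rewrite -(fK a) fa0.
      by apply: (can_inj fK); rewrite f'K linear0.
    move=> b c bc0; have := dom (f' b) (f' c).
    have -> : (f' b * f' c)%g = 0.
      by apply: (can_inj fK); rewrite fM !f'K linear0.
    case=> // /(congr1 f); rewrite f'K linear0; by [left | right].
  have [a [b]] := rose_noncomm K Ev wt_ge2 wt_e0.
  by apply; apply: (can_inj fK); rewrite !fM; exact: LPA_domain_comm.
have [e [g wt_eg]] := E_weights.
(* Least weight, found by maximizing the difference from [vwt v]; the subtraction is exact since no
   weight exceeds [vwt v]. *)
have [em _ em_max] := seq_argmax (fun e : edge E => vwt v - wt e)%N e0 (edges v).
have le_v (h : edge E) := wt_le_vwt Ev h.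
have em_min (h : edge E) : (wt em <= wt h)%N.
  have := em_max h; rewrite inE mem_edges // orbT => /(_ isT).
  by have := le_v h; have := le_v em; lia.
apply: (rose_not_leavitt Ev wt_ge2 wt_e0 em_min).
rewrite wt_e0 ltn_neqAle le_v andbT; apply/eqP => em_v; apply: wt_eg.
have := em_min e; have := em_min g; have := le_v e; have := le_v g.
by rewrite em_v; lia.
Qed.
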